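(* Let $n\ge1$ be an integer. For the class $\mathcal{S}_n$, the sharp $\mathcal{S}^*_{\rho,n}$-radius is given by $$R_{\mathcal{S}^*_{\rho,n}}(\mathcal{S}_n) = \left(\frac{\sinh^{-1}(1)}{n + \sqrt{n^2 + \left(\sinh^{-1}(1)\right)^2}} \right)^{1/n}.$$
   Context: $\mathbb{D}=\{z\in\mathbb{C}:|z|<1\}$. For an integer $n\ge1$, $\mathcal{A}_n$ is the class of analytic functions $f$ on $\mathbb{D}$ of the form $f(z)=z+a_{n+1}z^{n+1}+a_{n+2}z^{n+2}+\cdots$, and $\mathcal{A}=\mathcal{A}_1$. For analytic $g,h$ on $\mathbb{D}$, $g\prec h$ (subordination) means $g=h\circ\omega$ for some analytic $\omega$ on $\mathbb{D}$ with $\omega(0)=0$ and $|\omega(z)|\le|z|$. $\sinh^{-1}(z)=\ln(z+\sqrt{1+z^2})$ is the principal branch (analytic in $\mathbb{D}$, $\sinh^{-1}(0)=0$). $\mathcal{S}^*_{\rho}=\{f\in\mathcal{A}: zf'(z)/f(z)\prec 1+\sinh^{-1}(z)\}$ and $\mathcal{S}^*_{\rho,n}=\mathcal{A}_n\cap\mathcal{S}^*_\rho$. $\mathcal{P}_n$ is the class of analytic functions $p(z)=1+\sum_{k\ge n}c_kz^k$ on $\mathbb{D}$ with $p(z)\prec(1+z)/(1-z)$ (i.e. $\operatorname{Re}p>0$ in $\mathbb{D}$). $\mathcal{S}_n=\{f\in\mathcal{A}_n: f(z)/z\in\mathcal{P}_n\}$. For $G_1,G_2\subset\mathcal{A}$,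 the (sharp) $G_1$-radius $R_{G_1}(G_2)$ of $G_2$ is the greatest number $r_0\in(0,1]$ such that for every $g\in G_2$ and every $0<r\le r_0$ the function $z\mapsto r^{-1}g(rz)$ belongs to $G_1$. *)

(* Defs.v *)
From Stdlib Require Import Reals.
From Coquelicot Require Import Coquelicot.

Open Scope C_scope.

(** Functions on the unit disk are represented by total functions [C -> C];
    their values outside the disk are never used. *)
Definition in_disk (z : C) : Prop := (Cmod z < 1)%R.

Definition analytic_on_disk (f : C -> C) : Prop :=
  forall z : C, in_disk z -> @ex_derive C_AbsRing C_NormedModule f z.

Definition power_series_on_disk (a : nat -> C) (f : C -> C) : Prop :=
  forall z : C, in_disk z -> @is_pseries C_AbsRing C_NormedModule a z (f z).

Definition subordinate (g h : C -> C) : Prop :=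
  exists omega : C -> C,
    analytic_on_disk omega /\
    omega 0 = 0 /\
    (forall z : C, in_disk z -> (Cmod (omega z) <= Cmod z)%R) /\
    (forall z : C, in_disk z -> g z = h (omega z)).

(** Principal argument, in (-PI, PI] for [z <> 0] (no meaning at [0]). *)
Definition Carg (z : C) : R :=
  if Rlt_dec (Im z) 0
  then (- acos (Re z / Cmod z))%R
  else acos (Re z / Cmod z).

Definition Clog (z : C) : C := (ln (Cmod z), Carg z).

(** Principal square root: the one with argument in (-PI/2, PI/2]. *)
Definition Csqrt (z : C) : C :=
  let x := sqrt ((Cmod z + Re z) / 2) in
  let y := sqrt ((Cmod z - Re z) / 2) in
  (x, if Rlt_dec (Im z) 0 then (- y)%R else y).

Definition Carcsinh (z : C) : C := Clog (z + Csqrt (1 + z * z)).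

(** f(z) = z + a_{n+1} z^{n+1} + a_{n+2} z^{n+2} + ... *)
Definition class_A (n : nat) (f : C -> C) : Prop :=
  analytic_on_disk f /\
  exists a : nat -> C,
    a 0%nat = 0 /\ a 1%nat = 1 /\
    (forall k : nat, (1 < k <= n)%nat -> a k = 0) /\
    power_series_on_disk a f.

(** z f'(z) / f(z).  For [f] in [class_A n], [f] has a simple zero at the
    origin, the singularity there is removable, and the value is 1. *)
Definition starlike_quotient (f : C -> C) (z : C) : C :=
  if Ceq_dec z 0 then 1 else z * C_derive f z / f z.

(** f(z) / z.  For [f] in [class_A n] the removable singularity at the origin
    has value f'(0) = 1. *)
Definition quotient_by_id (f : C -> C) (z : C) : C :=
  if Ceq_dec z 0 then 1 else f z / z.

(** [f z <> 0] for [z <> 0] says that z f'(z) / f(z) has no pole in the disk;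
    it must be explicit because division by zero is total here. *)
Definition class_Srho (f : C -> C) : Prop :=
  class_A 1 f /\
  (forall z : C, in_disk z -> z <> 0 -> f z <> 0) /\
  subordinate (starlike_quotient f) (fun z => 1 + Carcsinh z).

Definition class_Srho_n (n : nat) (f : C -> C) : Prop :=
  class_A n f /\ class_Srho f.

(** p(z) = 1 + c_n z^n + c_{n+1} z^{n+1} + ... *)
Definition class_P (n : nat) (p : C -> C) : Prop :=
  analytic_on_disk p /\
  (exists c : nat -> C,
    c 0%nat = 1 /\
    (forall k : nat, (1 <= k < n)%nat -> c k = 0) /\
    power_series_on_disk c p) /\
  subordinate p (fun z => (1 + z) / (1 - z)).

Definition class_S (n : nat) (f : C -> C) : Prop :=
  class_A n f /\ class_P n (quotient_by_id f).

Definition dilation (r : R) (g : C -> C) (z : C) : C :=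
  RtoC (/ r) * g (RtoC r * z).

Definition admissible_radius (G1 G2 : (C -> C) -> Prop) (r0 : R) : Prop :=
  (0 < r0 <= 1)%R /\
  forall (g : C -> C) (r : R), G2 g -> (0 < r <= r0)%R -> G1 (dilation r g).

(** [r0] is the G1-radius of G2. *)
Definition is_class_radius (G1 G2 : (C -> C) -> Prop) (r0 : R) : Prop :=
  admissible_radius G1 G2 r0 /\
  forall r1 : R, admissible_radius G1 G2 r1 -> (r1 <= r0)%R.

(* Main.v *)
Require Import Defs.
From Stdlib Require Import Reals Lra Lia IndefiniteDescription.
From Coquelicot Require Import Coquelicot.

(** Write f = z p with Re p > 0, so that z f'/f = 1 + z p'/p.  The key estimate is
      |z p'(z)| (1 - r^(2n)) <= 2 n r^n Re p(z),   r = |z|,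
    proved by Ahlfors' method instead of Herglotz or Schwarz-Pick.  In the
    coordinate zeta = log z it compares the pull-back |P'| / (2 Re P) of the
    hyperbolic metric by P(zeta) = p(exp zeta) with the metric
    n / (2 sinh (- n Re zeta)); both have curvature -4, hence at an interior
    maximum of (a small perturbation of) their ratio the second derivative test
    shows that the ratio is at most 1.

    For r^n <= t, where 2 n t = arcsinh 1 (1 - t^2), the estimate gives
    |u| <= arcsinh 1 |z| for u(z) = r z p'(r z) / p(r z), and since
    |sinh u| <= |u| / arcsinh 1 whenever |u| <= arcsinh 1, the function sinh u is
    the subordinating map.  Conversely Re (arcsinh w) < arcsinh 1 for |w| < 1, while
    z (1 + z^n) / (1 - z^n) attains z f'/f = 1 + arcsinh 1 at z = t^(1/n). *)

Bind Scope C_scope with C.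
Local Open Scope C_scope.

(** * Complex derivatives *)

(** The comparison metric is the disk metric |dw| / (1 - |w|^2) pulled back by w = exp (n zeta), and
    |P'| / (2 Re P) is the half-plane metric pulled back by P. For p = (1 + z^n) / (1 - z^n) the two
    agree, so the estimate is an equality there; the same p gives z p'/p = 2 n z^n / (1 - z^(2n)),
    whence the equation for t. The obstacle is that a maximum must exist on a non-compact
    half-plane. The period 2 pi i reduces the height to a compact interval. On the right, the
    half-plane is shrunk to Re zeta < - eps, whose metric blows up on the edge. On the left, the
    vanishing of c_1, ..., c_(n-1) makes P' decay like exp (n Re zeta), which keeps the ratio
    bounded, and an extra factor exp (eps Re zeta) makes it small. The logarithm of that factor is
    harmonic, so the Laplacian at the maximum does not see it. The comparison needs three
    derivatives of P and no integral formula: d/dzeta is z d/dz, which multiplies the k-th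
    coefficient of p by k, so everything reduces to termwise differentiation of power series. *)

Definition is_Cderive (f : C -> C) (z d : C) : Prop :=
  @is_derive C_AbsRing C_NormedModule f z d.

Lemma is_Cderive_eps (f : C -> C) (z d : C) :
  is_Cderive f z d <->
  forall eps : R, (0 < eps)%R -> exists delta : R, (0 < delta)%R /\
    forall y : C, (Cmod (y - z) < delta)%R ->
      (Cmod (f y - f z - (y - z) * d) <= eps * Cmod (y - z))%R.
Proof.
  split.
  - intros [_ H] eps Heps.
    destruct (H z (fun P HP => HP) (mkposreal eps Heps)) as [delta Hd].
    exists delta. split; [apply cond_pos|].
    intros y Hy. exact (Hd y Hy).
  - intros H. split.
    + apply (@is_linear_scal_l C_AbsRing C_NormedModule).
    + intros x Hx.
      pose proof (@is_filter_lim_locally_unique C_AbsRing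
                   (AbsRing_NormedModule C_AbsRing) z x Hx) as E.
      subst x. intros eps.
      destruct (H eps (cond_pos eps)) as [delta [Hdelta Hd]].
      exists (mkposreal delta Hdelta). intros y Hy. exact (Hd y Hy).
Qed.

(* Coquelicot puts two normed module structures on [C] over itself; the product
   and chain rules are stated for [AbsRing_NormedModule]. *)
Lemma is_Cderive_AbsRing (f : C -> C) (z d : C) :
  is_Cderive f z d <->
  @is_derive C_AbsRing (AbsRing_NormedModule C_AbsRing) f z d.
Proof.
  split; intros [_ H]; (split; [|exact H]).
  - apply (@is_linear_scal_l C_AbsRing (AbsRing_NormedModule C_AbsRing)).
  - apply (@is_linear_scal_l C_AbsRing C_NormedModule).
Qed.

(** The derivatives of 1/z and of a power series both come with an explicit second-order remainder;
    this is the form in which they are established. *)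
Lemma is_Cderive_of_quadratic (f : C -> C) (z d : C) (delta K : R) :
  (0 < delta)%R ->
  (forall h : C, (Cmod h < delta)%R ->
     (Cmod (f (z + h)%C - f z - h * d) <= K * Cmod h ^ 2)%R) ->
  is_Cderive f z d.
Proof.
  intros Hdelta H. apply is_Cderive_eps. intros eps Heps.
  assert (HK : (0 <= Rabs K)%R) by apply Rabs_pos.
  exists (Rmin delta (eps / (Rabs K + 1)))%R. split.
  { apply Rmin_glb_lt; [exact Hdelta|]. apply Rdiv_lt_0_compat; lra. }
  intros y Hy.
  specialize (H (y - z)%C). replace (z + (y - z))%C with y in H by ring.
  assert (H1 : (Cmod (y - z) < delta)%R)
    by (eapply Rlt_le_trans; [exact Hy | apply Rmin_l]).
  assert (H2 : (Cmod (y - z) < eps / (Rabs K + 1))%R)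
    by (eapply Rlt_le_trans; [exact Hy | apply Rmin_r]).
  apply H in H1. eapply Rle_trans; [exact H1|].
  set (m := Cmod (y - z)) in *.
  assert (Hm : (0 <= m)%R) by apply Cmod_ge_0.
  assert (H3 : (m * (Rabs K + 1) <= eps)%R).
  { apply Rlt_le in H2. apply (Rmult_le_compat_r (Rabs K + 1)) in H2; [|lra].
    field_simplify in H2; lra. }
  pose proof (Rle_abs K). nra.
Qed.

Lemma is_Cderive_mult (f g : C -> C) (z df dg : C) :
  is_Cderive f z df -> is_Cderive g z dg ->
  is_Cderive (fun w => (f w * g w)%C) z (df * g z + f z * dg).
Proof.
  rewrite !is_Cderive_AbsRing. intros Hf Hg.
  apply (@is_derive_mult C_AbsRing f g z df dg Hf Hg).
  intros; apply Cmult_comm.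
Qed.

(** The remainder is exactly h^2 / (z^2 (z + h)), and |z + h| >= |z| / 2 as soon as |h| < |z| /
    2. *)
Lemma is_Cderive_inv_id (z : C) : z <> 0 -> is_Cderive Cinv z (- / (z * z)).
Proof.
  intros Hz. pose proof (proj1 (Cmod_gt_0 z) Hz) as Hm.
  apply (is_Cderive_of_quadratic _ _ _ (Cmod z / 2)
           (/ (Cmod z ^ 2 * (Cmod z / 2)))%R); [lra|].
  intros h Hh.
  assert (Hzh : (Cmod z / 2 <= Cmod (z + h))%R).
  { pose proof (Cmod_triangle (z + h) (- h)) as T.
    replace (z + h + - h)%C with z in T by ring. rewrite Cmod_opp in T. lra. }
  assert (Hzh0 : z + h <> 0) by (apply Cmod_gt_0; lra).
  replace (/ (z + h) - / z - h * - / (z * z))%C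
    with (h * h * / (z * z * (z + h)))%C
    by (field; split; assumption).
  rewrite !Cmod_mult, Cmod_inv, !Cmod_mult
    by (apply Cmult_neq_0; [apply Cmult_neq_0|]; assumption).
  replace (Cmod h * Cmod h)%R with (Cmod h ^ 2)%R by ring.
  rewrite (Rmult_comm (/ _) (Cmod h ^ 2)).
  apply Rmult_le_compat_l; [apply pow2_ge_0|].
  apply Rinv_le_contravar; [apply Rmult_lt_0_compat; [apply pow_lt|]; lra|].
  replace (Cmod z ^ 2)%R with (Cmod z * Cmod z)%R by ring.
  apply Rmult_le_compat_l; nra.
Qed.

Lemma is_Cderive_comp (f g : C -> C) (z df dg : C) :
  is_Cderive f (g z) df -> is_Cderive g z dg ->
  is_Cderive (fun w => f (g w)) z (dg * df).
Proof.
  intros Hf Hg. apply is_Cderive_AbsRing in Hg.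
  exact (@is_derive_comp C_AbsRing C_NormedModule f g z df dg Hf Hg).
Qed.

Lemma is_Cderive_div (f g : C -> C) (z df dg : C) :
  is_Cderive f z df -> is_Cderive g z dg -> g z <> 0 ->
  is_Cderive (fun w => (f w / g w)%C) z ((df * g z - f z * dg) / (g z * g z)).
Proof.
  intros Hf Hg Hz.
  replace ((df * g z - f z * dg) / (g z * g z))%C
    with (df * / g z + f z * (dg * - / (g z * g z)))%C by (field; exact Hz).
  apply (is_Cderive_mult f (fun w => / g w)%C); [exact Hf|].
  apply (is_Cderive_comp Cinv g); [apply is_Cderive_inv_id, Hz | exact Hg].
Qed.

Lemma is_Cderive_id (z : C) : is_Cderive (fun w => w) z 1.
Proof. apply is_Cderive_AbsRing. exact (@is_derive_id C_AbsRing z). Qed.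

Lemma is_Cderive_const (c z : C) : is_Cderive (fun _ => c) z 0.
Proof. exact (@is_derive_const C_AbsRing C_NormedModule c z). Qed.

Lemma is_Cderive_plus (f g : C -> C) (z df dg : C) :
  is_Cderive f z df -> is_Cderive g z dg ->
  is_Cderive (fun w => (f w + g w)%C) z (df + dg).
Proof. exact (@is_derive_plus C_AbsRing C_NormedModule f g z df dg). Qed.

Lemma is_Cderive_minus (f g : C -> C) (z df dg : C) :
  is_Cderive f z df -> is_Cderive g z dg ->
  is_Cderive (fun w => (f w - g w)%C) z (df - dg).
Proof. exact (@is_derive_minus C_AbsRing C_NormedModule f g z df dg). Qed.

Lemma is_Cderive_pow (n : nat) (z : C) :
  is_Cderive (fun w => (w ^ n)%C) z (INR n * z ^ pred n).
Proof.
  induction n as [|n IH].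
  - simpl. replace (0 * 1)%C with (RtoC 0) by ring. exact (is_Cderive_const 1 z).
  - pose proof (is_Cderive_mult _ _ z _ _ (is_Cderive_id z) IH) as H.
    cbv beta in H. simpl pred. rewrite S_INR, RtoC_plus.
    replace ((INR n + 1) * z ^ n)%C with (1 * z ^ n + z * (INR n * z ^ pred n))%C.
    + exact H.
    + destruct n as [|n]; simpl pred; [simpl; ring|]. rewrite (Cpow_S z n). ring.
Qed.

(** * Complex power series *)

Definition is_Cseries (a : nat -> C) (l : C) : Prop :=
  @is_series C_AbsRing C_NormedModule a l.

Lemma is_Cpseries_iff (a : nat -> C) (z l : C) :
  @is_pseries C_AbsRing C_NormedModule a z l <->
  is_Cseries (fun k => (a k * z ^ k)%C) l.
Proof.
  split; intros H; refine (@is_series_ext C_AbsRing C_NormedModule _ _ _ _ H);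
    intros k; exact (Cmult_comm _ _).
Qed.

Lemma is_Cseries_bound (a : nat -> C) (l : C) (b : nat -> R) (L : R) :
  (forall k, (Cmod (a k) <= b k)%R) -> is_Cseries a l -> is_series b L ->
  (Cmod l <= L)%R.
Proof.
  intros Hab Ha Hb.
  assert (H : Rbar_le (Cmod l) L); [|exact H].
  apply (@filterlim_le nat eventually _
           (fun N => Cmod (@sum_n C_AbelianGroup a N)) (fun N => sum_n b N)).
  - exists 0%nat. intros N _.
    eapply Rle_trans;
      [apply (@norm_sum_n_m C_AbsRing C_NormedModule a 0 N)|].
    apply sum_n_m_le. intros k. apply Hab.
  - apply (filterlim_comp _ _ _ (fun N => @sum_n C_AbelianGroup a N)
             (fun z : C => Cmod z) eventually (locally l) (Rbar_locally (Cmod l)));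
      [exact Ha|].
    exact (@filterlim_norm C_AbsRing C_NormedModule l).
  - exact Hb.
Qed.

Lemma is_Cseries_unique (a : nat -> C) (l1 l2 : C) :
  is_Cseries a l1 -> is_Cseries a l2 -> l1 = l2.
Proof.
  intros H1 H2.
  exact (@filterlim_locally_unique nat C_AbsRing C_NormedModule eventually _
           _ l1 l2 H1 H2).
Qed.

(** Radius of convergence at least 1, expressed by bounded terms instead of convergence. This form
    passes easily to shifted coefficients and to k a_k, and summability is recovered by giving up a
    little of the radius. *)
Definition bounded_in_disk (a : nat -> C) : Prop :=
  forall rho : R, (0 < rho < 1)%R ->
    exists M : R, forall k : nat, (Cmod (a k) * rho ^ k <= M)%R.

Lemma bounded_of_eventually (u : nat -> R) (B : R) (N : nat) :
  (forall k, (N <= k)%nat -> (u k <= B)%R) -> exists M, forall k, (u k <= M)%R.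
Proof.
  revert B. induction N as [|N IH]; intros B H.
  - exists B. intros k. apply H. lia.
  - apply (IH (Rmax B (u N))). intros k Hk.
    destruct (Nat.eq_dec k N) as [->|Hne]; [apply Rmax_r|].
    eapply Rle_trans; [apply H; lia | apply Rmax_l].
Qed.

Lemma power_series_bounded (a : nat -> C) (f : C -> C) :
  power_series_on_disk a f -> bounded_in_disk a.
Proof.
  intros H rho Hrho.
  assert (Hin : in_disk (RtoC rho))
    by (unfold in_disk; rewrite Cmod_R, Rabs_pos_eq; lra).
  apply H, is_Cpseries_iff in Hin.
  destruct (@Cauchy_ex_series C_AbsRing C_CompleteNormedModule _
              (ex_intro _ _ Hin) (mkposreal 1 Rlt_0_1)) as [N HN].
  apply (bounded_of_eventually (fun k => Cmod (a k) * rho ^ k)%R 1 N).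
  (* The Cauchy criterion for the block from k to k, which is a single term. *)
  intros k Hk. specialize (HN k k Hk Hk).
  rewrite sum_n_n in HN. simpl in HN. apply Rlt_le in HN.
  eapply Rle_trans; [|exact HN].
  change (Cmod (a k) * rho ^ k <= Cmod (a k * RtoC rho ^ k))%R.
  rewrite Cmod_mult, Cmod_pow, Cmod_R, (Rabs_pos_eq rho); lra.
Qed.

(** Coefficients of z f'. Writing the larger radius as s = rho (1 + x), Bernoulli's inequality k x <
    (1 + x)^k absorbs the factor k. *)
Lemma bounded_in_disk_euler (a : nat -> C) :
  bounded_in_disk a -> bounded_in_disk (fun k => (INR k * a k)%C).
Proof.
  intros H rho Hrho.
  destruct (H ((1 + rho) / 2)%R) as [M HM]; [lra|].
  set (s := ((1 + rho) / 2)%R) in *.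
  set (x := (s / rho - 1)%R).
  assert (Hs : (s = rho * (1 + x))%R) by (unfold x; field; lra).
  assert (Hx : (0 < x)%R).
  { cut (1 < s / rho)%R; [unfold x; lra|].
    apply (Rmult_lt_reg_r rho); [lra|]. unfold s. field_simplify; lra. }
  exists (M / x)%R. intros k. specialize (HM k).
  rewrite Hs, Rpow_mult_distr in HM.
  pose proof (poly k x Hx) as Hk.
  rewrite Cmod_mult, Cmod_R, (Rabs_pos_eq (INR k)) by apply pos_INR.
  apply (Rmult_le_reg_r x); [exact Hx|].
  replace (M / x * x)%R with M by (field; lra).
  eapply Rle_trans; [|exact HM].
  assert (Hp : (0 <= Cmod (a k) * rho ^ k)%R)
    by (apply Rmult_le_pos; [apply Cmod_ge_0 | apply pow_le; lra]).
  replace (INR k * Cmod (a k) * rho ^ k * x)%R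
    with (Cmod (a k) * rho ^ k * (INR k * x))%R by ring.
  rewrite <- (Rmult_assoc (Cmod (a k))).
  apply Rmult_le_compat_l; [exact Hp|]. lra.
Qed.

Lemma bounded_in_disk_shift (a : nat -> C) :
  bounded_in_disk a -> bounded_in_disk (fun k => a (S k)).
Proof.
  intros H rho Hrho. destruct (H rho Hrho) as [M HM].
  exists (M / rho)%R. intros k. specialize (HM (S k)). simpl in HM.
  apply (Rmult_le_reg_r rho); [lra|].
  replace (M / rho * rho)%R with M by (field; lra). lra.
Qed.

(** Comparison with a geometric series of ratio rho / s, where s is the midpoint of rho and 1. *)
Lemma bounded_in_disk_summable (a : nat -> C) (rho : R) :
  bounded_in_disk a -> (0 <= rho < 1)%R ->
  ex_series (fun k => (Cmod (a k) * rho ^ k)%R).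
Proof.
  intros H Hrho.
  destruct (H ((1 + rho) / 2)%R) as [M HM]; [lra|].
  set (s := ((1 + rho) / 2)%R) in *.
  assert (Hs : (0 < s)%R) by (unfold s; lra).
  apply (ex_series_le (K := R_AbsRing) (V := R_CompleteNormedModule) _
           (fun k => (rho / s) ^ k * M)%R).
  - intros k. change (norm ?x) with (Rabs x).
    rewrite Rabs_pos_eq
      by (apply Rmult_le_pos; [apply Cmod_ge_0 | apply pow_le; lra]).
    replace rho with (rho / s * s)%R at 1 by (field; lra).
    rewrite Rpow_mult_distr.
    assert (0 <= (rho / s) ^ k)%R
      by (apply pow_le; apply Rmult_le_pos; [lra|]; left; apply Rinv_0_lt_compat; lra).
    specialize (HM k). nra.
  - apply ex_series_scal_r. apply ex_series_geom.
    rewrite Rabs_pos_eq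
      by (apply Rmult_le_pos; [lra|]; left; apply Rinv_0_lt_compat; lra).
    apply (Rmult_lt_reg_r s); [exact Hs|]. unfold Rdiv.
    rewrite Rmult_assoc, Rinv_l by lra. unfold s. lra.
Qed.

Lemma bounded_in_disk_power_series (a : nat -> C) :
  bounded_in_disk a -> exists f, power_series_on_disk a f.
Proof.
  intros H.
  assert (E : forall z : C, exists l : C,
             in_disk z -> is_Cseries (fun k => (a k * z ^ k)%C) l).
  { intros z. destruct (Rlt_dec (Cmod z) 1) as [Hz|Hz].
    - destruct (@ex_series_le C_AbsRing C_CompleteNormedModule
                  (fun k => (a k * z ^ k)%C) (fun k => Cmod (a k) * Cmod z ^ k)%R)
        as [l Hl].
      + intros k. change (norm ?x) with (Cmod x).
        rewrite Cmod_mult, Cmod_pow. apply Rle_refl.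
      + apply bounded_in_disk_summable; [exact H|]. split; [apply Cmod_ge_0|exact Hz].
      + exists l. intros _. exact Hl.
    - exists 0. intros Hin. contradiction. }
  destruct (functional_choice _ E) as [f Hf].
  exists f. intros z Hz. apply is_Cpseries_iff. apply Hf, Hz.
Qed.

Lemma power_series_shift (a : nat -> C) (q : C -> C) :
  power_series_on_disk (fun k => a (S k)) q ->
  power_series_on_disk a (fun z => (a 0%nat + z * q z)%C).
Proof.
  intros H z Hz. specialize (H z Hz).
  apply is_Cpseries_iff in H. apply is_Cpseries_iff.
  apply (@is_series_decr_1 C_AbsRing C_NormedModule).
  apply (@is_series_scal C_AbsRing C_NormedModule z) in H.
  eapply (@is_series_ext C_AbsRing C_NormedModule).
  2:{ replace (@plus C_NormedModule _ _) with (z * q z)%C; [exact H|].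
      change (z * q z = a 0%nat + z * q z + - (a 0%nat * z ^ 0))%C.
      simpl. ring. }
  intros k. change (z * (a (S k) * z ^ k) = a (S k) * z ^ S k)%C.
  rewrite Cpow_S. ring.
Qed.

Lemma power_series_unique (a : nat -> C) (f g : C -> C) (z : C) :
  power_series_on_disk a f -> power_series_on_disk a g -> in_disk z -> f z = g z.
Proof.
  intros Hf Hg Hz. apply (is_Cseries_unique (fun k => (a k * z ^ k)%C));
    apply is_Cpseries_iff; [apply Hf | apply Hg]; exact Hz.
Qed.

(** One factor z is peeled off at a time. The quotient is again a power series, hence bounded near
    the origin, so the factorization controls the order of vanishing there. *)
Lemma power_series_factor (n : nat) (a : nat -> C) (f : C -> C) :
  power_series_on_disk a f -> (forall k, (k < n)%nat -> a k = 0) ->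
  exists q, power_series_on_disk (fun k => a (n + k)%nat) q /\
    forall z, in_disk z -> f z = z ^ n * q z.
Proof.
  revert a f. induction n as [|n IH]; intros a f Hf Ha.
  - exists f. split; [exact Hf|]. intros z _. simpl. ring.
  - destruct (bounded_in_disk_power_series (fun k => a (S k))) as [g Hg].
    { apply bounded_in_disk_shift. eapply power_series_bounded, Hf. }
    destruct (IH _ _ Hg) as (q & Hq & E).
    { intros k Hk. apply Ha. lia. }
    exists q. split; [exact Hq|]. intros z Hz.
    rewrite (power_series_unique a f _ z Hf (power_series_shift a g Hg) Hz).
    rewrite (Ha 0%nat) by lia. rewrite E by exact Hz. rewrite Cpow_S. ring.
Qed.

Lemma power_series_locally_bounded (a : nat -> C) (f : C -> C) (rho : R) :
  power_series_on_disk a f -> (0 <= rho < 1)%R ->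
  exists M : R, forall z, (Cmod z <= rho)%R -> (Cmod (f z) <= M)%R.
Proof.
  intros Hf Hrho.
  destruct (bounded_in_disk_summable a rho (power_series_bounded a f Hf) Hrho)
    as [M HM].
  exists M. intros z Hz.
  apply (is_Cseries_bound (fun k => (a k * z ^ k)%C) _
           (fun k => Cmod (a k) * rho ^ k)%R); [| |exact HM].
  - intros k. rewrite Cmod_mult, Cmod_pow. apply Rmult_le_compat_l; [apply Cmod_ge_0|].
    apply pow_incr. split; [apply Cmod_ge_0 | exact Hz].
  - apply is_Cpseries_iff, Hf. unfold in_disk. lra.
Qed.

(** With E_k the remainder, E_(k+1) = (z + h) E_k + k z^(k-1) h^2, and the constants add up because
    k^2 + k <= (k + 1)^2. The natural bound contains rho^(k-2); multiplying both sides by rho^2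
    avoids the truncated exponent. *)
Lemma Cpow_taylor_bound (rho : R) (z h : C) (k : nat) :
  (Cmod z <= rho)%R -> (Cmod (z + h) <= rho)%R ->
  (rho ^ 2 * Cmod ((z + h) ^ k - z ^ k - h * (INR k * z ^ pred k))
   <= INR k ^ 2 * rho ^ k * Cmod h ^ 2)%R.
Proof.
  intros Hz Hzh.
  assert (Hrho : (0 <= rho)%R) by (eapply Rle_trans; [apply Cmod_ge_0 | exact Hz]).
  induction k as [|k IH].
  - simpl. replace (1 - 1 - h * (0 * 1))%C with (RtoC 0) by ring.
    rewrite Cmod_0. lra.
  - set (E := ((z + h) ^ k - z ^ k - h * (INR k * z ^ pred k))%C) in *.
    replace ((z + h) ^ S k - z ^ S k - h * (INR (S k) * z ^ pred (S k)))%C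
      with ((z + h) * E + INR k * z ^ pred k * (h * h))%C.
    2:{ unfold E. simpl pred. rewrite !Cpow_S, S_INR, RtoC_plus.
        destruct k as [|k]; [simpl; ring|]. simpl pred. rewrite (Cpow_S z k). ring. }
    assert (H1 : (rho ^ 2 * Cmod ((z + h) * E) <=
                  INR k ^ 2 * rho ^ S k * Cmod h ^ 2)%R).
    { rewrite Cmod_mult. simpl pow.
      pose proof (Cmod_ge_0 E). pose proof (Cmod_ge_0 (z + h)).
      simpl pow in IH.
      apply Rle_trans with (rho * (rho * (rho * 1) * Cmod E))%R.
      - assert (0 <= rho * rho * Cmod E)%R by (repeat apply Rmult_le_pos; lra). nra.
      - apply (Rmult_le_compat_l rho) in IH; lra. }
    assert (H2 : (rho ^ 2 * Cmod (INR k * z ^ pred k * (h * h)) <=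
                  INR k * rho ^ S k * Cmod h ^ 2)%R).
    { rewrite !Cmod_mult, Cmod_pow, Cmod_R, (Rabs_pos_eq (INR k)) by apply pos_INR.
      destruct k as [|k]; [simpl; lra|]. simpl pred.
      assert (Hp : (Cmod z ^ k <= rho ^ k)%R)
        by (apply pow_incr; split; [apply Cmod_ge_0 | exact Hz]).
      pose proof (pos_INR (S k)). pose proof (Cmod_ge_0 h).
      replace (rho ^ 2 * (INR (S k) * Cmod z ^ k * (Cmod h * Cmod h)))%R
        with (INR (S k) * rho ^ 2 * Cmod h ^ 2 * Cmod z ^ k)%R by ring.
      replace (INR (S k) * rho ^ S (S k) * Cmod h ^ 2)%R
        with (INR (S k) * rho ^ 2 * Cmod h ^ 2 * rho ^ k)%R by (simpl; ring).
      apply Rmult_le_compat_l; [|exact Hp].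
      repeat apply Rmult_le_pos; try lra; apply pow2_ge_0. }
    apply Rle_trans with
      (rho ^ 2 * (Cmod ((z + h) * E) + Cmod (INR k * z ^ pred k * (h * h))))%R.
    + apply Rmult_le_compat_l; [apply pow2_ge_0 | apply Cmod_triangle].
    + rewrite S_INR. pose proof (pos_INR k).
      assert (0 <= rho ^ S k * Cmod h ^ 2)%R
        by (apply Rmult_le_pos; [apply pow_le, Hrho | apply pow2_ge_0]).
      nra.
Qed.

(** The series is given for z f' rather than f', so that the lemma can be iterated to follow d/dzeta
    in the coordinate zeta = log z. At a radius rho midway between |z| and 1, the sum L of k^2 |a_k|
    rho^k dominates the termwise Taylor remainders. *)
Lemma power_series_derive (a : nat -> C) (f : C -> C) :
  power_series_on_disk a f ->
  exists df : C -> C,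
    (forall z, in_disk z -> is_Cderive f z (df z)) /\
    power_series_on_disk (fun k => (INR k * a k)%C) (fun z => (z * df z)%C).
Proof.
  intros Hf. pose proof (power_series_bounded a f Hf) as Ha.
  pose proof (bounded_in_disk_euler a Ha) as Hb.
  destruct (bounded_in_disk_power_series _ (bounded_in_disk_shift _ Hb))
    as [df Hdf].
  exists df. split.
  2:{ intros z Hz. pose proof (power_series_shift (fun k => (INR k * a k)%C) df Hdf z Hz) as H.
      cbv beta in H. simpl INR in H.
      replace (z * df z)%C with (0 * a 0%nat + z * df z)%C by ring. exact H. }
  intros z Hz.
  set (rho := ((1 + Cmod z) / 2)%R).
  pose proof (Cmod_ge_0 z) as Hz0. unfold in_disk in Hz.
  destruct (bounded_in_disk_summable _ rho (bounded_in_disk_euler _ Hb))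
    as [L HL]; [unfold rho; lra|].
  apply (is_Cderive_of_quadratic f z (df z) (rho - Cmod z) (L / rho ^ 2)%R);
    [unfold rho; lra|].
  intros h Hh.
  assert (Hrho : (0 < rho)%R) by (unfold rho; lra).
  assert (Hzh : (Cmod (z + h) <= rho)%R)
    by (pose proof (Cmod_triangle z h); lra).
  assert (S1 : is_Cseries (fun k => (a k * (z + h) ^ k)%C) (f (z + h)%C))
    by (apply is_Cpseries_iff, Hf; unfold in_disk, rho in *; lra).
  assert (S2 : is_Cseries (fun k => (a k * z ^ k)%C) (f z))
    by (apply is_Cpseries_iff, Hf; exact Hz).
  assert (S3 : is_Cseries (fun k => (a k * (INR k * z ^ pred k))%C) (df z)).
  { apply (@is_series_decr_1 C_AbsRing C_NormedModule).
    specialize (Hdf z Hz). apply is_Cpseries_iff in Hdf.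
    eapply (@is_series_ext C_AbsRing C_NormedModule).
    2:{ replace (@plus C_NormedModule _ _) with (df z); [exact Hdf|].
        change (df z = df z + - (a 0%nat * (0 * 1)))%C. ring. }
    intros k.
    change (INR (S k) * a (S k) * z ^ k = a (S k) * (INR (S k) * z ^ k))%C. ring. }
  apply (@is_series_scal C_AbsRing C_NormedModule h) in S3.
  pose proof (@is_series_minus C_AbsRing C_NormedModule _ _ _ _
    (@is_series_minus C_AbsRing C_NormedModule _ _ _ _ S1 S2) S3) as S4.
  apply (is_series_scal_r (Cmod h ^ 2 / rho ^ 2)) in HL.
  replace (L / rho ^ 2 * Cmod h ^ 2)%R with (L * (Cmod h ^ 2 / rho ^ 2))%R
    by (field; lra).
  refine (is_Cseries_bound _ _ _ _ _ S4 HL).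
  intros k. cbv beta.
  change (Cmod (a k * (z + h) ^ k + - (a k * z ^ k) +
                - (h * (a k * (INR k * z ^ pred k))))
    <= Cmod (INR k * (INR k * a k)) * rho ^ k * (Cmod h ^ 2 / rho ^ 2))%R.
  replace (a k * (z + h) ^ k + - (a k * z ^ k) +
             - (h * (a k * (INR k * z ^ pred k))))%C
    with (a k * ((z + h) ^ k - z ^ k - h * (INR k * z ^ pred k)))%C by ring.
  rewrite !Cmod_mult, Cmod_R, (Rabs_pos_eq (INR k)) by apply pos_INR.
  replace (INR k * (INR k * Cmod (a k)) * rho ^ k * (Cmod h ^ 2 / rho ^ 2))%R
    with (Cmod (a k) * (INR k ^ 2 * rho ^ k * Cmod h ^ 2 / rho ^ 2))%R
    by (field; lra).
  apply Rmult_le_compat_l; [apply Cmod_ge_0|].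
  apply (Rmult_le_reg_l (rho ^ 2)); [apply pow_lt, Hrho|].
  eapply Rle_trans; [apply (Cpow_taylor_bound rho z h k); [unfold rho; lra | exact Hzh]|].
  right. field. lra.
Qed.

(** * Maxima of real functions of two variables *)

(** The maximum over y is taken for each x, and then the resulting envelope is maximized over x.
    Uniform continuity of f makes the envelope continuous, although the maximizing y need not depend
    continuously on x. *)
Lemma rectangle_max (f : R -> R -> R) (a b c d : R) :
  (a <= b)%R -> (c <= d)%R ->
  (forall x y, (a <= x <= b)%R -> (c <= y <= d)%R -> continuity_2d_pt f x y) ->
  exists x0 y0, (a <= x0 <= b)%R /\ (c <= y0 <= d)%R /\
    forall x y, (a <= x <= b)%R -> (c <= y <= d)%R -> (f x y <= f x0 y0)%R.
Proof.
  intros Hab Hcd Hf.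
  pose proof (uniform_continuity_2d f a b c d Hf) as U.
  (* Clamping to the rectangle: the one-variable extreme value theorem asks for two-sided continuity
     at the end points too. *)
  set (p := fun x => Rmax a (Rmin b x)). set (q := fun y => Rmax c (Rmin d y)).
  assert (Hp : forall x, (a <= p x <= b)%R)
    by (intros x; unfold p, Rmax, Rmin; repeat destruct Rle_dec; lra).
  assert (Hq : forall y, (c <= q y <= d)%R)
    by (intros y; unfold q, Rmax, Rmin; repeat destruct Rle_dec; lra).
  assert (Hpl : forall x y, (Rabs (p x - p y) <= Rabs (x - y))%R).
  { intros x y. unfold p, Rmax, Rmin.
    repeat destruct Rle_dec; unfold Rabs; repeat destruct Rcase_abs; lra. }
  assert (Hql : forall x y, (Rabs (q x - q y) <= Rabs (x - y))%R).
  { intros x y. unfold q, Rmax, Rmin.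
    repeat destruct Rle_dec; unfold Rabs; repeat destruct Rcase_abs; lra. }
  assert (Hpid : forall x, (a <= x <= b)%R -> p x = x)
    by (intros x Hx; unfold p, Rmax, Rmin; repeat destruct Rle_dec; lra).
  assert (Hqid : forall y, (c <= y <= d)%R -> q y = y)
    by (intros x Hx; unfold q, Rmax, Rmin; repeat destruct Rle_dec; lra).
  assert (HY : forall x, exists y, (c <= y <= d)%R /\
             forall y', (c <= y' <= d)%R -> (f (p x) y' <= f (p x) y)%R).
  { intros x.
    destruct (continuity_ab_maj (fun y => f (p x) (q y)) c d Hcd) as (y & Hy & Hyr).
    - intros y _ eps Heps. destruct (U (mkposreal eps Heps)) as [del Hdel].
      exists del. split; [apply cond_pos|]. intros z [_ Hz].
      simpl in Hz |- *. unfold R_dist in *.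
      apply Hdel; auto.
      + rewrite Rminus_diag, Rabs_R0. apply cond_pos.
      + eapply Rle_lt_trans; [apply Hql | exact Hz].
    - exists y. split; [exact Hyr|]. intros y' Hy'.
      specialize (Hy y' Hy'). cbv beta in Hy. rewrite !Hqid in Hy; assumption. }
  destruct (functional_choice _ HY) as [Y HYs].
  destruct (continuity_ab_maj (fun x => f (p x) (Y x)) a b Hab) as (x0 & Hx0 & Hx0r).
  - intros x _ eps Heps. destruct (U (mkposreal eps Heps)) as [del Hdel].
    exists del. split; [apply cond_pos|]. intros z [_ Hz].
    simpl in Hz, Hdel |- *. unfold R_dist in *.
    assert (Hpz : (Rabs (p z - p x) < del)%R)
      by (eapply Rle_lt_trans; [apply Hpl | exact Hz]).
    destruct (HYs x) as [Hx Hxm]. destruct (HYs z) as [Hz' Hzm].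
    assert (H0 : forall y, (Rabs (y - y) < del)%R)
      by (intros y; rewrite Rminus_diag, Rabs_R0; apply cond_pos).
    (* Each maximizer is tried at the other abscissa, which bounds the difference of the two maxima
       from both sides. *)
    pose proof (Hdel (p x) (Y x) (p z) (Y x) (Hp x) Hx (Hp z) Hx Hpz (H0 _)) as D1.
    pose proof (Hdel (p x) (Y z) (p z) (Y z) (Hp x) Hz' (Hp z) Hz' Hpz (H0 _)) as D2.
    specialize (Hxm _ Hz'). specialize (Hzm _ Hx).
    apply Rabs_def2 in D1. apply Rabs_def2 in D2. apply Rabs_def1; lra.
  - exists x0, (Y x0). split; [exact Hx0r|]. split; [apply HYs|].
    intros x y Hx Hy. specialize (Hx0 x Hx). cbv beta in Hx0.
    destruct (HYs x) as [_ Hxm]. specialize (Hxm y Hy).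
    rewrite (Hpid x Hx) in *. rewrite (Hpid x0 Hx0r) in *. lra.
Qed.

Lemma is_derive_local (f : R -> R) (x l eps : R) :
  is_derive f x l -> (0 < eps)%R ->
  exists delta, (0 < delta)%R /\ forall y, (Rabs (y - x) < delta)%R ->
    (Rabs (f y - f x - (y - x) * l) <= eps * Rabs (y - x))%R.
Proof.
  intros [_ H] Heps.
  destruct (H x (fun P HP => HP) (mkposreal eps Heps)) as [delta Hd].
  exists delta. split; [apply cond_pos|]. intros y Hy. exact (Hd y Hy).
Qed.

(** If l > 0, then G1 is positive just to the right of 0 when G1 0 >= 0, and negative just to the
    left when G1 0 < 0. Either way the mean value theorem produces a nearby value above G 0. *)
Lemma second_derivative_local_max (G G1 : R -> R) (l delta : R) :
  (0 < delta)%R ->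
  (forall t, (Rabs t < delta)%R -> is_derive G t (G1 t)) ->
  is_derive G1 0 l ->
  (forall t, (Rabs t < delta)%R -> (G t <= G 0)%R) ->
  (l <= 0)%R.
Proof.
  intros Hdelta HG HG1 Hmax. apply Rnot_lt_le. intros Hl.
  destruct (is_derive_local G1 0 l (l / 2) HG1) as (del & Hdel & Hd); [lra|].
  set (t := (Rmin delta del / 2)%R).
  assert (Ht : (0 < t /\ t < delta /\ t < del)%R).
  { unfold t. pose proof (Rmin_l delta del). pose proof (Rmin_r delta del).
    pose proof (Rmin_glb_lt _ _ _ Hdelta Hdel). lra. }
  destruct (Rle_lt_dec 0 (G1 0)) as [H0|H0].
  - destruct (MVT_cor2 G G1 0 t) as (c & Hc & Hcr); [lra| |].
    + intros c Hc. apply is_derive_Reals, HG. rewrite Rabs_pos_eq; lra.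
    + specialize (Hd c). rewrite Rminus_0_r, (Rabs_pos_eq c) in Hd by lra.
      specialize (Hd ltac:(lra)). apply Rabs_le_between in Hd.
      specialize (Hmax t). rewrite Rabs_pos_eq in Hmax by lra.
      specialize (Hmax ltac:(lra)). assert (0 < G1 c)%R by nra. nra.
  - destruct (MVT_cor2 G G1 (- t) 0) as (c & Hc & Hcr); [lra| |].
    + intros c Hc. apply is_derive_Reals, HG. rewrite Rabs_left1; lra.
    + specialize (Hd c). rewrite Rminus_0_r, (Rabs_left1 c) in Hd by lra.
      specialize (Hd ltac:(lra)). apply Rabs_le_between in Hd.
      specialize (Hmax (- t)%R). rewrite Rabs_left1 in Hmax by lra.
      specialize (Hmax ltac:(lra)). assert (G1 c < 0)%R by nra. nra.
Qed.

(** Restriction to the lines with directions 1 and [Ci] turns a Laplacian at [zeta] into two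
    ordinary second derivatives. *)
Lemma is_derive_Re_Im_line (F : C -> C) (zeta e d : C) (t : R) :
  (Cmod e <= 1)%R -> is_Cderive F (zeta + t * e) d ->
  is_derive (fun s : R => Re (F (zeta + s * e))) t (Re (d * e)) /\
  is_derive (fun s : R => Im (F (zeta + s * e))) t (Im (d * e)).
Proof.
  intros He HF. rewrite is_Cderive_eps in HF.
  assert (K : forall eps : posreal, exists delta : posreal, forall s : R,
            (Rabs (s - t) < delta)%R ->
            (Cmod (F (zeta + s * e)%C - F (zeta + t * e)%C - (s - t) * (d * e))
             <= eps * Rabs (s - t))%R).
  { intros eps. destruct (HF eps (cond_pos eps)) as (del & Hdel & Hd).
    exists (mkposreal del Hdel). simpl. intros s Hs.
    specialize (Hd (zeta + s * e)).
    replace (zeta + s * e - (zeta + t * e))%C with ((s - t)%R * e)%C in Hd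
      by (rewrite RtoC_minus; ring).
    rewrite Cmod_mult, Cmod_R in Hd.
    assert (Hm : (Rabs (s - t) * Cmod e <= Rabs (s - t))%R)
      by (pose proof (Rabs_pos (s - t)); pose proof (Cmod_ge_0 e); nra).
    specialize (Hd ltac:(lra)).
    replace ((s - t) * (d * e))%C with ((s - t)%R * e * d)%C
      by (rewrite RtoC_minus; ring).
    eapply Rle_trans; [exact Hd|].
    apply Rmult_le_compat_l; [left; apply cond_pos | exact Hm]. }
  split; (split; [apply (@is_linear_scal_l R_AbsRing R_NormedModule)|]);
    intros x Hx;
    pose proof (@is_filter_lim_locally_unique R_AbsRing
                  (AbsRing_NormedModule R_AbsRing) t x Hx) as E; subst x;
    intros eps; destruct (K eps) as [del Hd]; exists del; intros s Hs;
    specialize (Hd s Hs); eapply Rle_trans; [|exact Hd| |exact Hd].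
  - eapply Rle_trans; [|apply re_le_Cmod]. right. unfold Re, Im, Cminus, Cplus, Copp, Cmult, RtoC; simpl.
    apply f_equal. unfold minus, plus, opp, scal; simpl. unfold mult; simpl. ring.
  - eapply Rle_trans; [|eapply Rle_trans; [apply Rmax_r | apply Rmax_Cmod]].
    right. unfold Re, Im, Cminus, Cplus, Copp, Cmult, RtoC; simpl.
    apply f_equal. unfold minus, plus, opp, scal; simpl. unfold mult; simpl. ring.
Qed.

(** * A gradient estimate on the left half-plane *)

(** The second derivative test for twice the logarithm of the metric ratio along one line: A + i B
    is the restriction of P', U that of Re P, and k collects the comparison metric and the
    perturbation. Stated for arbitrary real functions, it serves both directions. *)
Lemma log_local_max (A B U k A1 B1 U1 k1 : R -> R) (A2 B2 U2 k2 delta : R) :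
  (0 < delta)%R ->
  (forall t, (Rabs t < delta)%R ->
     is_derive A t (A1 t) /\ is_derive B t (B1 t) /\
     is_derive U t (U1 t) /\ is_derive k t (k1 t)) ->
  is_derive A1 0 A2 -> is_derive B1 0 B2 ->
  is_derive U1 0 U2 -> is_derive k1 0 k2 ->
  (forall t, (Rabs t < delta)%R -> (0 < A t ^ 2 + B t ^ 2 /\ 0 < U t)%R) ->
  (forall t, (Rabs t < delta)%R ->
     (ln (A t ^ 2 + B t ^ 2) - 2 * ln (U t) + k t
      <= ln (A 0 ^ 2 + B 0 ^ 2) - 2 * ln (U 0) + k 0)%R) ->
  (2 * (A1 0 ^ 2 + B1 0 ^ 2 + A 0 * A2 + B 0 * B2) / (A 0 ^ 2 + B 0 ^ 2)
   - 4 * (A 0 * A1 0 + B 0 * B1 0) ^ 2 / (A 0 ^ 2 + B 0 ^ 2) ^ 2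
   - 2 * (U2 / U 0 - U1 0 ^ 2 / U 0 ^ 2) + k2 <= 0)%R.
Proof.
  intros Hdelta HD HA1 HB1 HU1 Hk1 Hpos Hmax.
  assert (H0 : (Rabs 0 < delta)%R) by (rewrite Rabs_R0; exact Hdelta).
  apply (second_derivative_local_max
    (fun t => ln (A t ^ 2 + B t ^ 2) - 2 * ln (U t) + k t)%R
    (fun t => 2 * (A t * A1 t + B t * B1 t) / (A t ^ 2 + B t ^ 2)
              - 2 * (U1 t / U t) + k1 t)%R _ delta Hdelta).
  - intros t Ht. destruct (HD t Ht) as (HA & HB & HU & Hk).
    destruct (Hpos t Ht) as [HN HU0].
    auto_derive.
    + repeat split; trivial; try (eexists; eassumption).
    + rewrite (is_derive_unique (fun x : R => A x) _ _ HA), (is_derive_unique (fun x : R => B x) _ _ HB),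
        (is_derive_unique (fun x : R => U x) _ _ HU), (is_derive_unique (fun x : R => k x) _ _ Hk).
      field. split; lra.
  - destruct (HD 0%R H0) as (HA & HB & HU & Hk).
    destruct (Hpos 0%R H0) as [HN HU0].
    auto_derive.
    + repeat split; try (eexists; eassumption); lra.
    + rewrite (is_derive_unique (fun x : R => A x) _ _ HA), (is_derive_unique (fun x : R => B x) _ _ HB),
        (is_derive_unique (fun x : R => U x) _ _ HU), (is_derive_unique (fun x : R => A1 x) _ _ HA1),
        (is_derive_unique (fun x : R => B1 x) _ _ HB1), (is_derive_unique (fun x : R => U1 x) _ _ HU1),
        (is_derive_unique (fun x : R => k1 x) _ _ Hk1).
      field. split; lra.
  - exact Hmax.
Qed.

Lemma sinh_pos (x : R) : (0 < x)%R -> (0 < sinh x)%R.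
Proof. intros Hx. rewrite <- sinh_0. apply sinh_lt, Hx. Qed.

Lemma exp_le_compat (x y : R) : (x <= y)%R -> (exp x <= exp y)%R.
Proof. intros [H| ->]; [left; apply exp_increasing, H | right; reflexivity]. Qed.

Lemma cosh2_minus_sinh2 (x : R) : (cosh x ^ 2 - sinh x ^ 2 = 1)%R.
Proof.
  unfold cosh, sinh.
  replace (((exp x + exp (- x)) / 2) ^ 2 - ((exp x - exp (- x)) / 2) ^ 2)%R
    with (exp x * exp (- x))%R by field.
  rewrite <- exp_plus, Rplus_opp_r. apply exp_0.
Qed.

(** The doubled logarithm lets |P'|^2 = Re^2 + Im^2 stand in for the modulus, so no square root has
    to be differentiated. *)
Lemma ln_square_quotient (m u s x : R) :
  (0 < m)%R -> (0 < u)%R -> (0 < s)%R ->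
  (ln (m ^ 2) - 2 * ln u + (2 * ln s + 2 * x) = 2 * ln (m / u * s * exp x))%R.
Proof.
  intros Hm Hu Hs.
  assert (Hmu : (0 < m / u)%R) by (apply Rdiv_lt_0_compat; assumption).
  rewrite ln_mult by (try apply exp_pos; apply Rmult_lt_0_compat; assumption).
  rewrite ln_exp, ln_mult by assumption.
  unfold Rdiv. rewrite ln_mult, ln_Rinv by (try apply Rinv_0_lt_compat; assumption).
  simpl. rewrite Rmult_1_r, ln_mult by assumption. ring.
Qed.

Lemma continuous_at_eps (F : C -> C) (z d : C) :
  is_Cderive F z d ->
  forall eps, (0 < eps)%R -> exists delta, (0 < delta)%R /\
    forall y, (Cmod (y - z) < delta)%R -> (Cmod (F y - F z) < eps)%R.
Proof.
  intros HF eps Heps. rewrite is_Cderive_eps in HF.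
  destruct (HF 1%R Rlt_0_1) as (del & Hdel & Hd).
  pose proof (Cmod_ge_0 d) as Hd0.
  assert (Hq : (0 < eps / (Cmod d + 2))%R) by (apply Rdiv_lt_0_compat; lra).
  exists (Rmin del (eps / (Cmod d + 2)))%R.
  split; [apply Rmin_glb_lt; lra|].
  intros y Hy.
  assert (Hy1 := Rlt_le_trans _ _ _ Hy (Rmin_l _ _)).
  assert (Hy2 := Rlt_le_trans _ _ _ Hy (Rmin_r _ _)).
  specialize (Hd y Hy1).
  replace (F y - F z) with ((F y - F z - (y - z) * d) + (y - z) * d) by ring.
  eapply Rle_lt_trans; [apply Cmod_triangle|]. rewrite Cmod_mult.
  apply (Rmult_lt_compat_r (Cmod d + 2)) in Hy2; [|lra].
  replace (eps / (Cmod d + 2) * (Cmod d + 2))%R with eps in Hy2 by (field; lra).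
  pose proof (Cmod_ge_0 (y - z)). lra.
Qed.

Lemma continuity_2d_pt_of_eps (f : C -> R) (x y : R) :
  (forall eps, (0 < eps)%R -> exists delta, (0 < delta)%R /\
     forall w, (Cmod (w - (x, y)) < delta)%R -> (Rabs (f w - f (x, y)) < eps)%R) ->
  continuity_2d_pt (fun x y => f (x, y)) x y.
Proof.
  intros H eps. destruct (H eps (cond_pos eps)) as (d & Hd & Hc).
  assert (Hd2 : (0 < d / 2)%R) by lra.
  exists (mkposreal _ Hd2). intros u v Hu Hv. simpl in Hu, Hv. apply Hc.
  replace ((u, v) - (x, y)) with (RtoC (u - x) + Ci * RtoC (v - y))
    by (unfold Cminus, Cplus, Cmult, Copp, Ci, RtoC; simpl; f_equal; ring).
  eapply Rle_lt_trans; [apply Cmod_triangle|].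
  rewrite Cmod_mult, Cmod_Ci, !Cmod_R. lra.
Qed.

Section HalfPlane.

(** [H0] plays the role of P(zeta) = p(exp zeta), and [H1], [H2], [H3] are its successive
    derivatives. *)
Variables (n : R) (H0 H1 H2 H3 : C -> C).
Hypothesis n_pos : (0 < n)%R.
Hypothesis H0_der : forall zeta, (Re zeta < 0)%R -> is_Cderive H0 zeta (H1 zeta).
Hypothesis H1_der : forall zeta, (Re zeta < 0)%R -> is_Cderive H1 zeta (H2 zeta).
Hypothesis H2_der : forall zeta, (Re zeta < 0)%R -> is_Cderive H2 zeta (H3 zeta).
Hypothesis H0_pos : forall zeta, (Re zeta < 0)%R -> (0 < Re (H0 zeta))%R.

(* The ratio vanishes at [Re zeta = S], and for [eps > 0] the last factor makes it
   tend to 0 as [Re zeta] tends to minus infinity; so its maximum is attained. *)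
Definition metric_ratio (S eps : R) (zeta : C) : R :=
  (Cmod (H1 zeta) / Re (H0 zeta) * sinh (n * (S - Re zeta))
   * exp (eps * Re zeta))%R.

(** At a local maximum the Laplacian of the logarithm of the ratio is at most 0. In it, ln |H1| and
    eps Re zeta are harmonic, - ln (Re H0) contributes |H1|^2 / (Re H0)^2, and ln sinh contributes -
    n^2 / sinh^2; this is the claim squared. *)
Lemma metric_ratio_local_max (S eps delta : R) (zeta : C) :
  (Re zeta < S)%R -> (S <= 0)%R -> (0 < delta)%R -> H1 zeta <> 0 ->
  (forall w, (Cmod (w - zeta) < delta)%R ->
     (metric_ratio S eps w <= metric_ratio S eps zeta)%R) ->
  (Cmod (H1 zeta) * sinh (n * (S - Re zeta)) <= n * Re (H0 zeta))%R.
Proof.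
  intros HzS HS Hdelta Hnz Hmax.
  assert (Hz : (Re zeta < 0)%R) by lra.
  apply Cmod_gt_0 in Hnz.
  destruct (continuous_at_eps H1 zeta _ (H1_der _ Hz) (Cmod (H1 zeta)) Hnz)
    as (d1 & Hd1 & Hc1).
  (* Within distance d the maximality holds, [H1] does not vanish, and the point stays to the left
     of Re = S, so all logarithms make sense. *)
  set (d := Rmin (Rmin delta d1) (S - Re zeta)%R).
  assert (Hd : (0 < d)%R) by (unfold d; repeat apply Rmin_glb_lt; lra).
  assert (Hddelta : (d <= delta)%R)
    by (unfold d; eapply Rle_trans; [apply Rmin_l | apply Rmin_l]).
  assert (Hdd1 : (d <= d1)%R)
    by (unfold d; eapply Rle_trans; [apply Rmin_l | apply Rmin_r]).
  assert (HdS : (d <= S - Re zeta)%R) by (unfold d; apply Rmin_r).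
  assert (Hnear : forall w, (Cmod (w - zeta) < d)%R ->
    (Re w < S /\ 0 < Cmod (H1 w) /\ metric_ratio S eps w <= metric_ratio S eps zeta)%R).
  { intros w Hw. split; [|split].
    - pose proof (re_le_Cmod (w - zeta)) as Hre.
      replace (Re (w - zeta)) with (Re w - Re zeta)%R in Hre by reflexivity.
      apply Rabs_le_between in Hre. lra.
    - specialize (Hc1 w ltac:(lra)).
      pose proof (Cmod_triangle (H1 w) (H1 zeta - H1 w)) as T.
      replace (H1 w + (H1 zeta - H1 w)) with (H1 zeta) in T by ring.
      replace (H1 zeta - H1 w) with (- (H1 w - H1 zeta)) in T by ring.
      rewrite Cmod_opp in T. lra.
    - apply Hmax. lra. }
  assert (Hlog : forall w, (Cmod (w - zeta) < d)%R ->
    (ln (Re (H1 w) ^ 2 + Im (H1 w) ^ 2) - 2 * ln (Re (H0 w))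
      + (2 * ln (sinh (n * (S - Re w))) + 2 * (eps * Re w))
     <= ln (Re (H1 zeta) ^ 2 + Im (H1 zeta) ^ 2) - 2 * ln (Re (H0 zeta))
      + (2 * ln (sinh (n * (S - Re zeta))) + 2 * (eps * Re zeta)))%R).
  { intros w Hw. destruct (Hnear w Hw) as (HwS & Hw1 & Hwm).
    assert (Hsw : (0 < sinh (n * (S - Re w)))%R)
      by (apply sinh_pos, Rmult_lt_0_compat; lra).
    assert (Hsz : (0 < sinh (n * (S - Re zeta)))%R)
      by (apply sinh_pos, Rmult_lt_0_compat; lra).
    assert (Huw : (0 < Re (H0 w))%R) by (apply H0_pos; lra).
    assert (Huz : (0 < Re (H0 zeta))%R) by (apply H0_pos; lra).
    rewrite <- !Cmod2_alt, !ln_square_quotient by assumption.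
    apply Rmult_le_compat_l; [lra|].
    apply ln_le; [|exact Hwm].
    apply Rmult_lt_0_compat; [|apply exp_pos].
    apply Rmult_lt_0_compat; [|assumption]. apply Rdiv_lt_0_compat; assumption. }
  set (sh := sinh (n * (S - Re zeta))) in *.
  set (ch := cosh (n * (S - Re zeta))).
  assert (Hsh : (0 < sh)%R) by (apply sinh_pos, Rmult_lt_0_compat; lra).
  assert (Hline : forall e : C, Cmod e = 1%R -> forall t : R, (Rabs t < d)%R ->
            (Cmod (zeta + t * e - zeta) < d)%R).
  { intros e He t Ht. replace (zeta + t * e - zeta) with (RtoC t * e) by ring.
    rewrite Cmod_mult, He, Cmod_R. lra. }
  assert (Hz0 : forall e : C, zeta + 0%R * e = zeta) by (intros; ring).
  assert (Hder : forall e : C, Cmod e = 1%R -> forall t : R, (Rabs t < d)%R ->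
     is_derive (fun s : R => Re (H1 (zeta + s * e))) t (Re (H2 (zeta + t * e) * e)) /\
     is_derive (fun s : R => Im (H1 (zeta + s * e))) t (Im (H2 (zeta + t * e) * e)) /\
     is_derive (fun s : R => Re (H0 (zeta + s * e))) t (Re (H1 (zeta + t * e) * e))).
  { intros e He t Ht. destruct (Hnear _ (Hline e He t Ht)) as (Hr & _ & _).
    assert (Hr0 : (Re (zeta + t * e) < 0)%R) by lra.
    destruct (is_derive_Re_Im_line H1 zeta e _ t (Req_le _ _ He) (H1_der _ Hr0)).
    destruct (is_derive_Re_Im_line H0 zeta e _ t (Req_le _ _ He) (H0_der _ Hr0)).
    (split; [|split]); assumption. }
  assert (Hder2 : forall e : C, Cmod e = 1%R ->
     is_derive (fun s : R => Re (H2 (zeta + s * e) * e)) 0 (Re (H3 zeta * e * e)) /\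
     is_derive (fun s : R => Im (H2 (zeta + s * e) * e)) 0 (Im (H3 zeta * e * e)) /\
     is_derive (fun s : R => Re (H1 (zeta + s * e) * e)) 0 (Re (H2 zeta * e * e))).
  { intros e He.
    assert (M : forall (F : C -> C) (l : C), is_Cderive F zeta l ->
              is_Cderive (fun w => F w * e) (zeta + 0%R * e) (l * e)).
    { intros F l HF. rewrite Hz0.
      pose proof (is_Cderive_mult F (fun _ => e) zeta l 0 HF (is_Cderive_const e zeta)) as HM.
      replace (l * e) with (l * e + F zeta * 0) by ring. exact HM. }
    destruct (is_derive_Re_Im_line _ zeta e _ 0 (Req_le _ _ He) (M H2 _ (H2_der _ Hz))).
    destruct (is_derive_Re_Im_line _ zeta e _ 0 (Req_le _ _ He) (M H1 _ (H1_der _ Hz))).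
    (split; [|split]); assumption. }
  assert (Hpos : forall e : C, Cmod e = 1%R -> forall t : R, (Rabs t < d)%R ->
     (0 < Re (H1 (zeta + t * e)) ^ 2 + Im (H1 (zeta + t * e)) ^ 2 /\
      0 < Re (H0 (zeta + t * e)))%R).
  { intros e He t Ht. destruct (Hnear _ (Hline e He t Ht)) as (Hr & Hm & _).
    split; [rewrite <- Cmod2_alt; apply pow_lt, Hm | apply H0_pos; lra]. }
  (* [T1] is the horizontal and [T2] the vertical second derivative; their sum is the Laplacian. On
     the vertical line Re zeta is fixed, so there the comparison term is constant. *)
  assert (T1 := log_local_max
    (fun t => Re (H1 (zeta + t * 1))) (fun t => Im (H1 (zeta + t * 1)))
    (fun t => Re (H0 (zeta + t * 1)))
    (fun t => 2 * ln (sinh (n * (S - (Re zeta + t)))) + 2 * (eps * (Re zeta + t)))%R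
    (fun t => Re (H2 (zeta + t * 1) * 1)) (fun t => Im (H2 (zeta + t * 1) * 1))
    (fun t => Re (H1 (zeta + t * 1) * 1))
    (fun t => - (2 * n * (cosh (n * (S - (Re zeta + t)))
                          / sinh (n * (S - (Re zeta + t))))) + 2 * eps)%R
    (Re (H3 zeta * 1 * 1)) (Im (H3 zeta * 1 * 1)) (Re (H2 zeta * 1 * 1))
    (- 2 * n ^ 2 / sh ^ 2)%R d Hd).
  assert (T2 := log_local_max
    (fun t => Re (H1 (zeta + t * Ci))) (fun t => Im (H1 (zeta + t * Ci)))
    (fun t => Re (H0 (zeta + t * Ci)))
    (fun t => 2 * ln sh + 2 * (eps * Re zeta))%R
    (fun t => Re (H2 (zeta + t * Ci) * Ci)) (fun t => Im (H2 (zeta + t * Ci) * Ci))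
    (fun t => Re (H1 (zeta + t * Ci) * Ci)) (fun _ => 0%R)
    (Re (H3 zeta * Ci * Ci)) (Im (H3 zeta * Ci * Ci)) (Re (H2 zeta * Ci * Ci))
    0%R d Hd).
  destruct (Hder2 1 Cmod_1) as (E1 & E2 & E3).
  destruct (Hder2 Ci Cmod_Ci) as (E4 & E5 & E6).
  assert (Hre1 : forall t : R, Re (zeta + t * 1) = (Re zeta + t)%R)
    by (intros t; unfold Re; simpl; ring).
  assert (Hrei : forall t : R, Re (zeta + t * Ci) = Re zeta)
    by (intros t; unfold Re; simpl; ring).
  assert (HK1 : forall t : R, (Rabs t < d)%R -> is_derive
    (fun t => 2 * ln (sinh (n * (S - (Re zeta + t)))) + 2 * (eps * (Re zeta + t)))%R t
    (- (2 * n * (cosh (n * (S - (Re zeta + t)))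
                 / sinh (n * (S - (Re zeta + t))))) + 2 * eps)%R).
  { intros t Ht. destruct (Hnear _ (Hline 1 Cmod_1 t Ht)) as (Hr & _ & _).
    rewrite Hre1 in Hr.
    pose proof (sinh_pos (n * (S - (Re zeta + t))) ltac:(apply Rmult_lt_0_compat; lra)).
    auto_derive.
    - assumption.
    - fold (S - (Re zeta + t))%R. field. lra. }
  assert (HK2 : is_derive
    (fun t => - (2 * n * (cosh (n * (S - (Re zeta + t)))
                 / sinh (n * (S - (Re zeta + t))))) + 2 * eps)%R 0
    (- 2 * n ^ 2 / sh ^ 2)%R).
  { auto_derive.
    - rewrite Rplus_0_r. exact (Rgt_not_eq _ _ Hsh).
    - rewrite Rplus_0_r. fold (S - Re zeta)%R. fold sh ch. pose proof (cosh2_minus_sinh2 (n * (S - Re zeta))) as I.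
      fold sh ch in I. replace (- 2 * n ^ 2 / sh ^ 2)%R
        with (- 2 * n ^ 2 * (ch ^ 2 - sh ^ 2) / sh ^ 2)%R by (rewrite I; field; lra).
      field. lra. }
  specialize (T1 ltac:(intros t Ht; destruct (Hder 1 Cmod_1 t Ht) as (D1 & D2 & D3);
                        exact (conj D1 (conj D2 (conj D3 (HK1 t Ht)))))
                 E1 E2 E3 HK2 (Hpos 1 Cmod_1)).
  specialize (T2 ltac:(intros t Ht; destruct (Hder Ci Cmod_Ci t Ht) as (D1 & D2 & D3);
                        exact (conj D1 (conj D2 (conj D3
                          (@is_derive_const R_AbsRing R_NormedModule _ t)))))
                 E4 E5 E6 (@is_derive_const R_AbsRing R_NormedModule _ _)
                 (Hpos Ci Cmod_Ci)).
  cbv beta in T1, T2. rewrite !Hz0 in T1. rewrite !Hz0 in T2.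
  rewrite Rplus_0_r in T1. fold sh in T1.
  assert (T1' := T1 ltac:(intros t Ht; rewrite <- (Hre1 t);
                          apply Hlog, (Hline 1 Cmod_1 t Ht))).
  assert (T2' := T2 ltac:(intros t Ht; rewrite <- (Hrei t);
     eapply Rle_trans; [|eapply Rle_trans; [exact (Hlog _ (Hline Ci Cmod_Ci t Ht))|]];
     rewrite ?Hrei; fold sh; apply Rle_refl)).
  clear T1 T2.
  pose proof (H0_pos zeta Hz) as Hu.
  assert (HN : (0 < Re (H1 zeta) ^ 2 + Im (H1 zeta) ^ 2)%R)
    by (rewrite <- Cmod2_alt; apply pow_lt, Hnz).
  pose proof (Cmod2_alt (H1 zeta)) as HCm.
  set (m := Cmod (H1 zeta)) in *.
  destruct (H1 zeta) as [a b]. destruct (H2 zeta) as [c e].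
  destruct (H3 zeta) as [f g]. destruct (H0 zeta) as [u v].
  unfold Re, Im in *. simpl fst in *. simpl snd in *.
  (* [ln |H1|] is harmonic: the terms in [H2] and [H3] cancel in the Laplacian. *)
  assert (K : (2 * m ^ 2 / u ^ 2 - 2 * n ^ 2 / sh ^ 2 <= 0)%R).
  { pose proof (Rplus_le_compat _ _ _ _ T1' T2') as T. rewrite !Rplus_0_r in T.
    eapply Rle_trans; [|exact T]. right. rewrite HCm. field. lra. }
  apply Rnot_lt_le. intros Hlt.
  assert (Hsq : ((n * u) ^ 2 < (m * sh) ^ 2)%R)
    by (assert (0 <= n * u)%R by (apply Rmult_le_pos; lra); nra).
  apply (Rmult_le_compat_r ((u * sh) ^ 2)) in K; [|apply pow2_ge_0].
  replace ((2 * m ^ 2 / u ^ 2 - 2 * n ^ 2 / sh ^ 2) * (u * sh) ^ 2)%R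
    with (2 * ((m * sh) ^ 2 - (n * u) ^ 2))%R in K by (field; lra).
  lra.
Qed.

Hypothesis H0_per : forall zeta, H0 (zeta + (0%R, (2 * PI)%R)) = H0 zeta.
Hypothesis H1_per : forall zeta, H1 (zeta + (0%R, (2 * PI)%R)) = H1 zeta.

Lemma metric_ratio_per (S eps x y : R) :
  metric_ratio S eps (x, (y + 2 * PI)%R) = metric_ratio S eps (x, y).
Proof.
  replace (x, (y + 2 * PI)%R) with ((x, y) + (0%R, (2 * PI)%R))
    by (unfold Cplus; simpl; rewrite Rplus_0_r; reflexivity).
  unfold metric_ratio. rewrite H0_per, H1_per.
  unfold Re; simpl. rewrite Rplus_0_r. reflexivity.
Qed.

Lemma metric_ratio_continuous (S eps x y : R) :
  (x < 0)%R -> continuity_2d_pt (fun x y => metric_ratio S eps (x, y)) x y.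
Proof.
  intros Hx. unfold metric_ratio, Rdiv. unfold Re at 2 3. simpl fst.
  assert (Hu : (0 < Re (H0 (x, y)))%R) by (apply H0_pos; exact Hx).
  apply continuity_2d_pt_mult;
    [apply continuity_2d_pt_mult; [apply continuity_2d_pt_mult|]|].
  - apply (continuity_2d_pt_of_eps (fun w => Cmod (H1 w))). intros e He.
    destruct (continuous_at_eps H1 (x, y) _ (H1_der (x, y) Hx) e He) as (d & Hd & Hc).
    exists d. split; [exact Hd|]. intros w Hw.
    eapply Rle_lt_trans; [|apply Hc, Hw].
    exact (@norm_triangle_inv C_AbsRing C_NormedModule (H1 w) (H1 (x, y))).
  - apply continuity_2d_pt_inv; [|lra].
    apply (continuity_2d_pt_of_eps (fun w => Re (H0 w))). intros e He.
    destruct (continuous_at_eps H0 (x, y) _ (H0_der (x, y) Hx) e He) as (d & Hd & Hc).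
    exists d. split; [exact Hd|]. intros w Hw.
    eapply Rle_lt_trans; [|apply Hc, Hw].
    exact (re_le_Cmod (H0 w - H0 (x, y))).
  - apply (continuity_1d_2d_pt_comp (fun x => sinh (n * (S - x))) (fun x _ => x));
      [|apply continuity_2d_pt_id1].
    apply derivable_continuous_pt, ex_derive_Reals_0. auto_derive. trivial.
  - apply (continuity_1d_2d_pt_comp (fun x => exp (eps * x)) (fun x _ => x));
      [|apply continuity_2d_pt_id1].
    apply derivable_continuous_pt, ex_derive_Reals_0. auto_derive. trivial.
Qed.

(** If the bound fails at one point, it still fails there for the perturbed ratio with small eps.
    That ratio is at most n far to the left, is 0 on the right edge and is periodic in height, so a
    value above n forces a maximum in the interior. There the local lemma bounds the ratio by n exp
    (eps x) <= n, a contradiction. *)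
Lemma half_plane_gradient_bound (K sigma : R) :
  (forall zeta, (Re zeta <= sigma)%R ->
     (Cmod (H1 zeta) <= K * exp (n * Re zeta) * Re (H0 zeta))%R) ->
  forall zeta, (Re zeta < 0)%R ->
    (Cmod (H1 zeta) * sinh (- (n * Re zeta)) <= n * Re (H0 zeta))%R.
Proof.
  intros Hdecay [s0 y0] Hs0. simpl in Hs0. apply Rnot_lt_le. intros Hbad.
  set (m0 := Cmod (H1 (s0, y0))) in *. set (u0 := Re (H0 (s0, y0))) in *.
  unfold Re in Hbad; simpl fst in Hbad.
  assert (Hu0 : (0 < u0)%R) by (apply H0_pos; exact Hs0).
  assert (Heps : exists eps, (0 < eps /\ eps < - s0 /\
            n * u0 < m0 * sinh (n * (- eps - s0)) * exp (eps * s0))%R).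
  (* The strict failure is an open condition in the perturbation parameter; e = 0 is the unperturbed
     inequality. *)
  { set (phi := fun e => (m0 * sinh (n * (- e - s0)) * exp (e * s0))%R).
    assert (Hphi : continuity_pt phi 0).
    { apply derivable_continuous_pt, ex_derive_Reals_0. unfold phi. auto_derive. trivial. }
    assert (Hphi0 : (phi 0 = m0 * sinh (- (n * s0)))%R).
    { unfold phi. rewrite Rmult_0_l, exp_0. replace (n * (- 0 - s0))%R with (- (n * s0))%R by ring.
      ring. }
    destruct (Hphi (phi 0 - n * u0)%R) as (al & Hal & Hc); [rewrite Hphi0; lra|].
    simpl in Hc. unfold R_dist, D_x, no_cond in Hc.
    exists (Rmin al (- s0) / 2)%R.
    pose proof (Rmin_l al (- s0)). pose proof (Rmin_r al (- s0)).
    pose proof (Rmin_glb_lt al (- s0) 0 Hal ltac:(lra)).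
    split; [lra|]. split; [lra|].
    specialize (Hc (Rmin al (- s0) / 2)%R).
    rewrite Rminus_0_r, (Rabs_pos_eq (_ / 2)) in Hc by lra.
    specialize (Hc ltac:(split; [split; [trivial | lra] | lra])).
    apply Rabs_def2 in Hc. fold (phi (Rmin al (- s0) / 2)%R). lra. }
  destruct Heps as (eps & Heps & Hes & Hbig).
  set (Q := metric_ratio (- eps) eps).
  assert (HQ0 : (n < Q (s0, y0))%R).
  { unfold Q, metric_ratio. fold m0 u0. unfold Re; simpl fst.
    apply (Rmult_lt_reg_r u0); [exact Hu0|].
    replace (m0 / u0 * sinh (n * (- eps - s0)) * exp (eps * s0) * u0)%R
      with (m0 * sinh (n * (- eps - s0)) * exp (eps * s0))%R by (field; lra).
    exact Hbig. }
  assert (Hleft : exists s1, (s1 < s0 /\ s1 < - eps /\ forall y, Q (s1, y) <= n)%R).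
  (* [sigma] gives access to the decay hypothesis, the two middle bounds keep the bad point and the
     right edge to the right of s1, and the last one makes exp (eps s1) <= n / (|K| + 1). The decay
     exp (n s1) cancels the growth of sinh, which leaves at most |K| + 1 for the other factors. *)
  { set (s1 := Rmin (Rmin sigma (s0 - 1)) (Rmin (- eps - 1) (ln (n / (Rabs K + 1)) / eps))).
    assert (A1 : (s1 <= sigma)%R) by (eapply Rle_trans; [apply Rmin_l | apply Rmin_l]).
    assert (A2 : (s1 <= s0 - 1)%R) by (eapply Rle_trans; [apply Rmin_l | apply Rmin_r]).
    assert (A3 : (s1 <= - eps - 1)%R) by (eapply Rle_trans; [apply Rmin_r | apply Rmin_l]).
    assert (A4 : (s1 <= ln (n / (Rabs K + 1)) / eps)%R)
      by (eapply Rle_trans; [apply Rmin_r | apply Rmin_r]).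
    exists s1. split; [lra|]. split; [lra|]. intros y.
    pose proof (Rabs_pos K) as HK.
    assert (Hu : (0 < Re (H0 (s1, y)))%R) by (apply H0_pos; unfold Re; simpl; lra).
    pose proof (Hdecay (s1, y) A1) as Hd. unfold Re at 1 in Hd; simpl fst in Hd.
    set (m := Cmod (H1 (s1, y))) in *. set (u := Re (H0 (s1, y))) in *.
    unfold Q, metric_ratio. fold m u. unfold Re; simpl fst.
    assert (B1 : (m / u <= (Rabs K + 1) * exp (n * s1))%R).
    { apply (Rmult_le_reg_r u); [exact Hu|].
      replace (m / u * u)%R with m by (field; lra).
      eapply Rle_trans; [exact Hd|].
      pose proof (Rle_abs K). pose proof (exp_pos (n * s1)).
      apply Rmult_le_compat_r; [lra|]. apply Rmult_le_compat_r; lra. }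
    assert (B2 : (sinh (n * (- eps - s1)) <= exp (- (n * s1)))%R).
    { unfold sinh. pose proof (exp_pos (- (n * (- eps - s1)))).
      pose proof (exp_pos (n * (- eps - s1))).
      assert (exp (n * (- eps - s1)) <= exp (- (n * s1)))%R
        by (apply exp_le_compat; nra). lra. }
    assert (B3 : (exp (eps * s1) <= n / (Rabs K + 1))%R).
    { rewrite <- (exp_ln (n / (Rabs K + 1))) by (apply Rdiv_lt_0_compat; lra).
      apply exp_le_compat. apply (Rmult_le_compat_l eps) in A4; [|lra].
      replace (eps * (ln (n / (Rabs K + 1)) / eps))%R
        with (ln (n / (Rabs K + 1))) in A4 by (field; lra).
      exact A4. }
    assert (B0 : (0 <= m / u)%R)
      by (apply Rmult_le_pos; [apply Cmod_ge_0 | left; apply Rinv_0_lt_compat, Hu]).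
    assert (B4 : (0 < sinh (n * (- eps - s1)))%R)
      by (apply sinh_pos, Rmult_lt_0_compat; lra).
    assert (B5 : (exp (n * s1) * exp (- (n * s1)) = 1)%R)
      by (rewrite <- exp_plus, Rplus_opp_r; apply exp_0).
    assert (B6 : (m / u * sinh (n * (- eps - s1)) <= Rabs K + 1)%R).
    { eapply Rle_trans; [apply Rmult_le_compat; [lra | lra | exact B1 | exact B2]|].
      rewrite Rmult_assoc, B5. lra. }
    apply Rle_trans with ((Rabs K + 1) * (n / (Rabs K + 1)))%R.
    - apply Rmult_le_compat; [apply Rmult_le_pos; lra | left; apply exp_pos | exact B6 | exact B3].
    - right. field. lra. }
  destruct Hleft as (s1 & Hs10 & Hs1e & HQ1).
  pose proof PI_RGT_0 as HPI.
  destruct (rectangle_max (fun x y => Q (x, y)) s1 (- eps) y0 (y0 + 2 * PI))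
    as (x & y & Hx & Hy & Hmax); [lra | lra | |].
  { intros x y Hx _. apply metric_ratio_continuous. lra. }
  assert (HQ : (n < Q (x, y))%R)
    by (eapply Rlt_le_trans; [exact HQ0 | apply Hmax; lra]).
  assert (Hxl : (s1 < x)%R).
  { destruct (Req_dec x s1) as [E|E]; [|lra]. subst x. specialize (HQ1 y). lra. }
  assert (Hxr : (x < - eps)%R).
  { destruct (Req_dec x (- eps)) as [E|E]; [|lra]. exfalso.
    unfold Q, metric_ratio in HQ. rewrite E in HQ. unfold Re in HQ. simpl fst in HQ.
    replace (n * (- eps - - eps))%R with 0%R in HQ by ring.
    rewrite sinh_0, Rmult_0_r, Rmult_0_l in HQ. lra. }
  assert (Hu : (0 < Re (H0 (x, y)))%R) by (apply H0_pos; unfold Re; simpl; lra).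
  assert (Hloc : (Cmod (H1 (x, y)) * sinh (n * (- eps - Re (x, y)))
                  <= n * Re (H0 (x, y)))%R).
  (* The ball stays inside the rectangle horizontally. Vertically it may leave it, but by less than
     one period since its radius is at most 1; such points are translated back by 2 pi. *)
  { apply (metric_ratio_local_max (- eps) eps (Rmin 1 (Rmin (x - s1) (- eps - x)))).
    - exact Hxr.
    - lra.
    - repeat apply Rmin_glb_lt; lra.
    - intros E. unfold Q, metric_ratio in HQ. rewrite E, Cmod_0 in HQ.
      unfold Rdiv in HQ. rewrite !Rmult_0_l in HQ. lra.
    - intros [a b] Hw.
      assert (D1 := Rlt_le_trans _ _ _ Hw (Rmin_l _ _)).
      assert (D2 := Rlt_le_trans _ _ _ Hw (Rmin_r _ _)).
      assert (D3 := Rlt_le_trans _ _ _ D2 (Rmin_l _ _)).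
      assert (D4 := Rlt_le_trans _ _ _ D2 (Rmin_r _ _)).
      pose proof (Rmax_Cmod ((a, b) - (x, y))) as Hm. simpl in Hm.
      assert (M1 := Rle_trans _ _ _ (Rmax_l _ _) Hm).
      assert (M2 := Rle_trans _ _ _ (Rmax_r _ _) Hm).
      apply Rabs_le_between in M1. apply Rabs_le_between in M2.
      fold (Q (a, b)) (Q (x, y)).
      pose proof PI2_1.
      destruct (Rlt_le_dec b y0) as [Hb|Hb].
      + unfold Q at 1. rewrite <- metric_ratio_per. apply Hmax; lra.
      + destruct (Rlt_le_dec (y0 + 2 * PI) b) as [Hb'|Hb'].
        * replace b with (b - 2 * PI + 2 * PI)%R by ring.
          unfold Q at 1. rewrite metric_ratio_per. apply Hmax; lra.
        * apply Hmax; lra. }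
  unfold Re at 1 in Hloc; simpl fst in Hloc.
  revert HQ. apply Rle_not_lt. unfold Q, metric_ratio. unfold Re at 2 3; simpl fst.
  set (m := Cmod (H1 (x, y))) in *. set (u := Re (H0 (x, y))) in *.
  assert (B1 : (m / u * sinh (n * (- eps - x)) <= n)%R).
  { apply (Rmult_le_reg_r u); [exact Hu|].
    replace (m / u * sinh (n * (- eps - x)) * u)%R
      with (m * sinh (n * (- eps - x)))%R by (field; lra). exact Hloc. }
  assert (B2 : (exp (eps * x) <= 1)%R)
    by (rewrite <- exp_0; apply exp_le_compat; nra).
  pose proof (exp_pos (eps * x)). nra.
Qed.
End HalfPlane.

(** * Transfer to the disk *)

Definition Cexp (z : C) : C :=
  ((exp (Re z) * cos (Im z))%R, (exp (Re z) * sin (Im z))%R).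

Lemma Cexp_plus (z w : C) : Cexp (z + w) = Cexp z * Cexp w.
Proof.
  destruct z as [a b], w as [c d]. unfold Cexp, Cplus, Cmult, Re, Im; simpl.
  rewrite exp_plus, cos_plus, sin_plus. f_equal; ring.
Qed.

Lemma Cexp_0 : Cexp 0 = 1.
Proof.
  unfold Cexp, Re, Im, RtoC; simpl. rewrite exp_0, cos_0, sin_0. f_equal; ring.
Qed.

Lemma Cmod_Cexp (z : C) : Cmod (Cexp z) = exp (Re z).
Proof.
  unfold Cmod, Cexp. simpl fst. simpl snd.
  replace ((exp (Re z) * cos (Im z)) ^ 2 + (exp (Re z) * sin (Im z)) ^ 2)%R
    with (exp (Re z) ^ 2 * (Rsqr (sin (Im z)) + Rsqr (cos (Im z))))%R
    by (unfold Rsqr; ring).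
  rewrite sin2_cos2, Rmult_1_r. apply sqrt_pow2. left; apply exp_pos.
Qed.

Lemma Cexp_period (z : C) : Cexp (z + (0%R, (2 * PI)%R)) = Cexp z.
Proof.
  unfold Cexp, Cplus, Re, Im; simpl.
  rewrite Rplus_0_r, cos_plus, sin_plus, cos_2PI, sin_2PI. f_equal; ring.
Qed.

Lemma Cmod_le_Rabs_plus (x y : R) : (Cmod (x, y) <= Rabs x + Rabs y)%R.
Proof.
  replace (x, y) with (RtoC x + Ci * RtoC y)
    by (unfold Cplus, Cmult, Ci, RtoC; simpl; f_equal; ring).
  eapply Rle_trans; [apply Cmod_triangle|].
  rewrite Cmod_mult, Cmod_Ci, !Cmod_R. lra.
Qed.

Lemma is_Cderive_Cexp_0 : is_Cderive Cexp 0 1.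
Proof.
  apply is_Cderive_eps. intros e He.
  (* The errors below add up to 9 h |w|. The bound h <= 1 gives |exp x - 1| <= 2 |x| and exp x <=
     3. *)
  set (h := Rmin 1 (e / 12)).
  assert (Hh : (0 < h)%R) by (apply Rmin_glb_lt; lra).
  assert (Hh1 : (h <= 1)%R) by apply Rmin_l.
  assert (Hh2 : (h <= e / 12)%R) by apply Rmin_r.
  destruct (is_derive_local exp 0 1 h) as (d1 & Hd1 & E1); [|exact Hh|].
  { pose proof (is_derive_exp 0) as D. rewrite exp_0 in D. exact D. }
  destruct (is_derive_local cos 0 0 h) as (d2 & Hd2 & E2); [|exact Hh|].
  { pose proof (is_derive_cos 0) as D. rewrite sin_0, Ropp_0 in D. exact D. }
  destruct (is_derive_local sin 0 1 h) as (d3 & Hd3 & E3); [|exact Hh|].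
  { pose proof (is_derive_sin 0) as D. rewrite cos_0 in D. exact D. }
  exists (Rmin (Rmin d1 h) (Rmin d2 d3)).
  split; [apply Rmin_glb_lt; apply Rmin_glb_lt; assumption|].
  intros [x y] Hw. replace ((x, y) - 0) with (x, y) in * by
    (unfold Cminus, Cplus, Copp, RtoC; simpl; f_equal; ring).
  pose proof (Rmax_Cmod (x, y)) as Hm. simpl in Hm.
  assert (Mx := Rle_trans _ _ _ (Rmax_l _ _) Hm).
  assert (My := Rle_trans _ _ _ (Rmax_r _ _) Hm).
  assert (W1 := Rlt_le_trans _ _ _ Hw (Rmin_l _ _)).
  assert (W2 := Rlt_le_trans _ _ _ Hw (Rmin_r _ _)).
  assert (W3 := Rlt_le_trans _ _ _ W1 (Rmin_l _ _)).
  assert (W4 := Rlt_le_trans _ _ _ W1 (Rmin_r _ _)).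
  assert (W5 := Rlt_le_trans _ _ _ W2 (Rmin_l _ _)).
  assert (W6 := Rlt_le_trans _ _ _ W2 (Rmin_r _ _)).
  specialize (E1 x). specialize (E2 y). specialize (E3 y).
  rewrite Rminus_0_r in E1, E2, E3.
  specialize (E1 ltac:(lra)). specialize (E2 ltac:(lra)). specialize (E3 ltac:(lra)).
  rewrite exp_0 in E1. rewrite cos_0 in E2. rewrite sin_0 in E3.
  rewrite Cexp_0. unfold Cexp, Re, Im; simpl fst; simpl snd.
  set (m := Cmod (x, y)) in *.
  replace (((exp x * cos y)%R, (exp x * sin y)%R) - 1 - (x, y) * 1)
    with (((exp x * cos y - 1 - x)%R, (exp x * sin y - y)%R) : C)
    by (unfold Cminus, Cplus, Copp, Cmult, RtoC; simpl; f_equal; ring).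
  eapply Rle_trans; [apply Cmod_le_Rabs_plus|].
  pose proof (Rabs_pos x). pose proof (Rabs_pos y).
  assert (Hex : (Rabs (exp x - 1) <= 2 * Rabs x)%R).
  { replace (exp x - 1)%R with ((exp x - 1 - x * 1) + x)%R by ring.
    eapply Rle_trans; [apply Rabs_triang|]. nra. }
  assert (Hex3 : (exp x <= 3)%R) by (apply Rabs_le_between in Hex; lra).
  pose proof (exp_pos x) as Hexp.
  assert (R1 : (Rabs (exp x * cos y - 1 - x) <= h * m + 3 * (h * m))%R).
  { replace (exp x * cos y - 1 - x)%R
      with ((exp x - 1 - x * 1) + exp x * (cos y - 1 - y * 0))%R by ring.
    eapply Rle_trans; [apply Rabs_triang|].
    rewrite Rabs_mult, (Rabs_pos_eq (exp x)) by lra.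
    apply Rplus_le_compat.
    - eapply Rle_trans; [exact E1|]. apply Rmult_le_compat_l; lra.
    - apply Rmult_le_compat; [lra | apply Rabs_pos | lra |].
      eapply Rle_trans; [exact E2|]. apply Rmult_le_compat_l; lra. }
  assert (R2 : (Rabs (exp x * sin y - y) <= 3 * (h * m) + 2 * (h * m))%R).
  { replace (exp x * sin y - y)%R
      with (exp x * (sin y - 0 - y * 1) + (exp x - 1) * y)%R by ring.
    eapply Rle_trans; [apply Rabs_triang|].
    rewrite !Rabs_mult, (Rabs_pos_eq (exp x)) by lra.
    apply Rplus_le_compat.
    - apply Rmult_le_compat; [lra | apply Rabs_pos | lra |].
      eapply Rle_trans; [exact E3|]. apply Rmult_le_compat_l; lra.
    - rewrite <- Rmult_assoc.
      apply Rmult_le_compat; [apply Rabs_pos | lra | | lra].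
      eapply Rle_trans; [exact Hex|]. lra. }
  assert (0 <= m)%R by apply Cmod_ge_0. nra.
Qed.

(** The functional equation carries the derivative from 0 to z, with the tolerance divided by |exp
    z| = exp (Re z). *)
Lemma is_Cderive_Cexp (z : C) : is_Cderive Cexp z (Cexp z).
Proof.
  pose proof is_Cderive_Cexp_0 as H. rewrite is_Cderive_eps in H.
  apply is_Cderive_eps. intros e He.
  pose proof (exp_pos (Re z)) as Hz.
  destruct (H (e / exp (Re z))%R) as (d & Hd & E); [apply Rdiv_lt_0_compat; lra|].
  exists d. split; [exact Hd|]. intros y Hy.
  specialize (E (y - z)). replace (y - z - 0) with (y - z) in E by ring.
  specialize (E Hy). rewrite Cexp_0 in E.
  replace (Cexp y) with (Cexp z * Cexp (y - z))
    by (rewrite <- Cexp_plus; f_equal; ring).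
  replace (Cexp z * Cexp (y - z) - Cexp z - (y - z) * Cexp z)
    with (Cexp z * (Cexp (y - z) - 1 - (y - z) * 1)) by ring.
  rewrite Cmod_mult, Cmod_Cexp.
  apply (Rmult_le_compat_l (exp (Re z))) in E; [|lra].
  replace (exp (Re z) * (e / exp (Re z) * Cmod (y - z)))%R
    with (e * Cmod (y - z))%R in E by (field; lra).
  exact E.
Qed.

Lemma polar_form (z : C) :
  z <> 0 -> z = ((Cmod z * cos (Carg z))%R, (Cmod z * sin (Carg z))%R).
Proof.
  intros Hz. apply Cmod_gt_0 in Hz.
  pose proof (Cmod2_alt z) as H2.
  destruct z as [x y]. unfold Re, Im in H2; simpl fst in H2; simpl snd in H2.
  set (m := Cmod (x, y)) in *.
  assert (Hb : (-1 <= x / m <= 1)%R).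
  { assert (Hx : (Rabs x <= m)%R) by exact (re_le_Cmod (x, y)).
    apply Rabs_le_between in Hx.
    split; apply (Rmult_le_reg_r m); try exact Hz; unfold Rdiv;
      rewrite Rmult_assoc, Rinv_l by lra; lra. }
  assert (Hs : (m * sqrt (1 - Rsqr (x / m)) = Rabs y)%R).
  { replace (1 - Rsqr (x / m))%R with (Rsqr (y / m)).
    - rewrite sqrt_Rsqr_abs. unfold Rdiv. rewrite Rabs_mult, Rabs_inv, (Rabs_pos_eq m) by lra. field. lra.
    - unfold Rsqr. apply (Rmult_eq_reg_r (m ^ 2)); [|apply pow_nonzero; lra].
      field_simplify; [|lra|lra]. lra. }
  unfold Carg. unfold Re, Im; simpl fst; simpl snd. fold m.
  destruct (Rlt_dec y 0) as [Hy|Hy].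
  - rewrite cos_neg, sin_neg, cos_acos, sin_acos by exact Hb.
    f_equal; [field; lra|].
    rewrite <- Ropp_mult_distr_r, Hs, Rabs_left by exact Hy. ring.
  - rewrite cos_acos, sin_acos by exact Hb.
    f_equal; [field; lra|]. rewrite Hs, Rabs_pos_eq; lra.
Qed.

Lemma Cexp_Clog (z : C) : z <> 0 -> Cexp (Clog z) = z.
Proof.
  intros Hz. rewrite (polar_form z Hz) at 2.
  unfold Cexp, Clog, Re, Im; simpl. rewrite exp_ln by (apply Cmod_gt_0, Hz).
  reflexivity.
Qed.

Lemma exp_INR_mult (n : nat) (x : R) : exp (INR n * x) = (exp x ^ n)%R.
Proof.
  induction n as [|n IH]; [simpl; rewrite Rmult_0_l; apply exp_0|].
  rewrite S_INR, Rmult_plus_distr_r, Rmult_1_l, exp_plus, IH. simpl. ring.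
Qed.

(** The half-plane bound for p(exp zeta) at zeta = [Clog z]. There sinh (- n ln |z|) = (|z|^(-n) -
    |z|^n) / 2, and multiplication by 2 |z|^n gives the stated form. The origin, which has no
    logarithm, is treated separately. *)
Lemma positive_real_part_gradient_bound (n : nat) (c : nat -> C) (p dp : C -> C) :
  (1 <= n)%nat -> (forall k, (1 <= k < n)%nat -> c k = 0) ->
  power_series_on_disk c p ->
  (forall z, in_disk z -> is_Cderive p z (dp z)) ->
  power_series_on_disk (fun k => (INR k * c k)%C) (fun z => (z * dp z)%C) ->
  (forall z, in_disk z -> (0 < Re (p z))%R) ->
  forall z, in_disk z ->
    (Cmod (z * dp z) * (1 - (Cmod z ^ n) ^ 2) <= 2 * INR n * Cmod z ^ n * Re (p z))%R.
Proof.
  intros Hn Hc Hp Hdp Hpe Hpos z Hz.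
  assert (Hz0 := Cmod_ge_0 z).
  assert (Hn0 : (0 < INR n)%R) by (apply lt_0_INR; lia).
  destruct (Ceq_dec z 0) as [E|Hnz].
  { subst z. rewrite Cmult_0_l, Cmod_0, Rmult_0_l.
    specialize (Hpos 0 Hz). apply Rmult_le_pos; [|lra].
    apply Rmult_le_pos; [lra | apply pow_le; lra]. }
  destruct (power_series_derive _ _ Hpe) as (d2 & Hd2 & Hp2).
  destruct (power_series_derive _ _ Hp2) as (d3 & Hd3 & Hp3).
  (* The missing coefficients give z p' = z^n q with q bounded near 0: this is the decay like exp (n
     Re zeta). *)
  destruct (power_series_factor n _ _ Hpe) as (q & Hq & Efac).
  { intros k Hk. destruct k as [|k]; [simpl; ring|]. rewrite Hc by lia. ring. }
  destruct (power_series_locally_bounded _ q (1 / 2) Hq) as [M HM]; [lra|].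
  assert (H00 : in_disk 0) by (unfold in_disk; rewrite Cmod_0; lra).
  pose proof (Hpos 0 H00) as Hu.
  destruct (continuous_at_eps p 0 _ (Hdp 0 H00) (Re (p 0) / 2)) as (del & Hdel & Hcont);
    [lra|].
  assert (Hex : forall zeta, (Re zeta < 0)%R -> in_disk (Cexp zeta)).
  { intros zeta H. unfold in_disk. rewrite Cmod_Cexp, <- exp_0.
    apply exp_increasing, H. }
  assert (Hcomp : forall (F dF : C -> C), (forall w, in_disk w -> is_Cderive F w (dF w)) ->
    forall zeta, (Re zeta < 0)%R ->
      is_Cderive (fun w => F (Cexp w)) zeta (Cexp zeta * dF (Cexp zeta))).
  { intros F dF HF zeta H. apply is_Cderive_comp; [apply HF, Hex, H | apply is_Cderive_Cexp]. }
  assert (HM0 : (0 <= M)%R)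
    by (eapply Rle_trans; [apply Cmod_ge_0 | apply (HM 0); rewrite Cmod_0; lra]).
  (* Near the origin |q| <= M and, by continuity, Re p >= Re (p 0) / 2; the decay constant is the
     quotient of these two bounds. *)
  assert (HK : forall zeta, (Re zeta <= ln (Rmin (1 / 2) (del / 2)))%R ->
    (Cmod (Cexp zeta * dp (Cexp zeta)) <=
     M / (Re (p 0%C) / 2) * exp (INR n * Re zeta) * Re (p (Cexp zeta)))%R).
  { intros zeta Hzeta.
    assert (Hmin : (0 < Rmin (1 / 2) (del / 2))%R) by (apply Rmin_glb_lt; lra).
    assert (Hm : (Cmod (Cexp zeta) <= Rmin (1 / 2) (del / 2))%R).
    { rewrite Cmod_Cexp, <- (exp_ln _ Hmin). apply exp_le_compat, Hzeta. }
    pose proof (Rmin_l (1 / 2) (del / 2)). pose proof (Rmin_r (1 / 2) (del / 2)).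
    assert (Hin : in_disk (Cexp zeta)) by (unfold in_disk; lra).
    rewrite Efac by exact Hin. rewrite Cmod_mult, Cmod_pow, Cmod_Cexp.
    rewrite exp_INR_mult.
    specialize (HM (Cexp zeta) ltac:(lra)).
    specialize (Hcont (Cexp zeta)).
    replace (Cexp zeta - 0) with (Cexp zeta) in Hcont by ring.
    specialize (Hcont ltac:(lra)).
    pose proof (re_le_Cmod (p (Cexp zeta) - p 0)) as Hre.
    change (Re (p (Cexp zeta) - p 0)) with (Re (p (Cexp zeta)) - Re (p 0))%R in Hre.
    apply Rabs_le_between in Hre.
    set (u := Re (p 0)) in *. set (v := Re (p (Cexp zeta))) in *.
    assert (Hv : (u / 2 <= v)%R) by lra.
    pose proof (pow_lt (exp (Re zeta)) n (exp_pos _)) as Hpos'.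
    set (x := (exp (Re zeta) ^ n)%R) in *.
    replace (M / (u / 2) * x * v)%R with (x * (M * (v / (u / 2))))%R by (field; lra).
    apply Rmult_le_compat_l; [lra|].
    apply Rle_trans with (M * 1)%R; [lra|].
    apply Rmult_le_compat_l; [exact HM0|].
    apply (Rmult_le_reg_r (u / 2)); [lra|].
    replace (v / (u / 2) * (u / 2))%R with v by (field; lra). lra. }
  pose proof (half_plane_gradient_bound (INR n)
    (fun zeta => p (Cexp zeta)) (fun zeta => Cexp zeta * dp (Cexp zeta))
    (fun zeta => Cexp zeta * d2 (Cexp zeta)) (fun zeta => Cexp zeta * d3 (Cexp zeta))
    Hn0 (Hcomp p dp Hdp) (Hcomp (fun w => w * dp w) d2 Hd2)
    (Hcomp (fun w => w * d2 w) d3 Hd3)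
    (fun zeta H => Hpos _ (Hex zeta H))
    (fun zeta => f_equal p (Cexp_period zeta))
    (fun zeta => f_equal (fun w => w * dp w) (Cexp_period zeta))
    (M / (Re (p 0%C) / 2)) (ln (Rmin (1 / 2) (del / 2))) HK (Clog z)) as HB.
  cbv beta in HB. rewrite Cexp_Clog in HB by exact Hnz.
  apply Cmod_gt_0 in Hnz.
  assert (HRe : Re (Clog z) = ln (Cmod z)) by reflexivity.
  rewrite HRe in HB. unfold in_disk in Hz.
  assert (Hln : (ln (Cmod z) < 0)%R) by (rewrite <- ln_1; apply ln_increasing; lra).
  specialize (HB Hln).
  pose proof (pow_lt (Cmod z) n Hnz) as Hx.
  assert (Hex1 : exp (INR n * ln (Cmod z)) = (Cmod z ^ n)%R)
    by (rewrite exp_INR_mult, exp_ln by exact Hnz; reflexivity).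
  unfold sinh in HB. rewrite Ropp_involutive, exp_Ropp, Hex1 in HB.
  set (x := (Cmod z ^ n)%R) in *. set (m := Cmod (z * dp z)) in *.
  apply (Rmult_le_compat_r (2 * x)) in HB; [|lra].
  replace (m * ((/ x - x) / 2) * (2 * x))%R with (m * (1 - x ^ 2))%R in HB
    by (field; lra).
  lra.
Qed.

(** * The inverse hyperbolic sine *)

Lemma cosh_ge_1 (x : R) : (1 <= cosh x)%R.
Proof.
  pose proof (cosh2_minus_sinh2 x).
  assert (0 < cosh x)%R
    by (unfold cosh; pose proof (exp_pos x); pose proof (exp_pos (- x)); lra).
  nra.
Qed.

(** Convexity on the nonnegative half-line: the mean slopes on [0, x] and [x, a] are values of
    [cosh], which increases there. It is used with a = [arcsinh 1], where sinh a = 1. *)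
Lemma sinh_chord (a x : R) :
  (0 <= x <= a)%R -> (a * sinh x <= x * sinh a)%R.
Proof.
  intros Hx.
  destruct (Req_dec x 0) as [->|Hx0]; [rewrite sinh_0; lra|].
  destruct (Req_dec x a) as [->|Hxa]; [lra|].
  destruct (MVT_cor2 sinh cosh 0 x) as (c1 & E1 & B1); [lra | intros; apply derivable_pt_lim_sinh|].
  destruct (MVT_cor2 sinh cosh x a) as (c2 & E2 & B2); [lra | intros; apply derivable_pt_lim_sinh|].
  rewrite sinh_0 in E1.
  assert (Hc : (cosh c1 <= cosh c2)%R).
  { unfold cosh.
    destruct (MVT_cor2 cosh sinh c1 c2) as (c & E & B);
      [lra | intros; apply derivable_pt_lim_cosh|].
    pose proof (sinh_pos c ltac:(lra)). unfold cosh in E. nra. }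
  replace (sinh a) with (sinh x + cosh c2 * (a - x))%R by lra.
  replace (sinh x) with (cosh c1 * x)%R by lra.
  assert (0 <= x * (a - x))%R by nra. nra.
Qed.

Lemma arcsinh_1_pos : (0 < arcsinh 1)%R.
Proof. rewrite <- arcsinh_0. apply arcsinh_lt. lra. Qed.

(** Since sinh has slope at least 1, a <= sinh a = 1 for a = [arcsinh 1]. This gives |sin y| <= |y|
    <= |y| / a, and it places the disk of radius a in the strip |Im u| < pi / 2. *)
Lemma arcsinh_1_le_1 : (arcsinh 1 <= 1)%R.
Proof.
  pose proof arcsinh_1_pos as Ha. pose proof (sinh_arcsinh 1) as E.
  destruct (MVT_cor2 sinh cosh 0 (arcsinh 1)) as (c & E1 & B);
    [exact Ha | intros; apply derivable_pt_lim_sinh|].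
  rewrite sinh_0, E in E1. pose proof (cosh_ge_1 c). nra.
Qed.

Lemma Rabs_sinh_le (x : R) :
  (Rabs x <= arcsinh 1)%R -> (Rabs (sinh x) <= Rabs x / arcsinh 1)%R.
Proof.
  intros Hx. pose proof arcsinh_1_pos as Ha.
  assert (E : (Rabs (sinh x) = sinh (Rabs x))%R).
  { unfold Rabs at 2. destruct (Rcase_abs x) as [H|H].
    - replace (sinh (- x)) with (- sinh x)%R by (unfold sinh; rewrite Ropp_involutive; field).
      apply Rabs_left. pose proof (sinh_pos (- x) ltac:(lra)) as P.
      unfold sinh in *. rewrite Ropp_involutive in P. lra.
    - destruct (Req_dec x 0) as [->|H0]; [rewrite sinh_0; apply Rabs_R0|].
      apply Rabs_pos_eq. left. apply sinh_pos. lra. }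
  rewrite E. pose proof (sinh_chord (arcsinh 1) (Rabs x)) as C.
  rewrite sinh_arcsinh in C. specialize (C (conj (Rabs_pos x) Hx)).
  apply (Rmult_le_reg_l (arcsinh 1)); [exact Ha|].
  replace (arcsinh 1 * (Rabs x / arcsinh 1))%R with (Rabs x) by (field; lra). lra.
Qed.

Lemma Rabs_sin_le (x : R) : (Rabs (sin x) <= Rabs x)%R.
Proof.
  pose proof (bounded_variation sin cos 1 0 x) as B.
  rewrite sin_0, !Rminus_0_r, Rmult_1_l in B. apply B.
  intros t _. split; [apply is_derive_sin|].
  apply Rabs_le. pose proof (COS_bound t). lra.
Qed.

Definition Csinh (z : C) : C := (Cexp z - Cexp (- z)) / 2.

Lemma Csinh_components (x y : R) :
  Csinh (x, y) = ((sinh x * cos y)%R, (cosh x * sin y)%R).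
Proof.
  unfold Csinh, Cdiv.
  rewrite <- RtoC_inv by lra.
  unfold Cexp, sinh, cosh, Cminus, Cplus, Copp, Cmult, RtoC, Re, Im; simpl.
  rewrite cos_neg, sin_neg. f_equal; field.
Qed.

Lemma is_Cderive_Csinh (z : C) : is_Cderive Csinh z ((Cexp z + Cexp (- z)) / 2).
Proof.
  assert (HN : is_Cderive (fun w => - w) z (- (1))).
  { pose proof (is_Cderive_minus _ _ z _ _ (is_Cderive_const 0 z) (is_Cderive_id z)) as H.
    replace (- (1)) with (0 - 1) by ring.
    apply (@is_derive_ext C_AbsRing C_NormedModule (fun w => 0 - w)); [|exact H].
    intros t. change (0 - (t : C) = - (t : C)). ring. }
  pose proof (is_Cderive_comp Cexp (fun w => - w) z _ _ (is_Cderive_Cexp _) HN) as H1.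
  pose proof (is_Cderive_minus _ _ z _ _ (is_Cderive_Cexp z) H1) as H2.
  pose proof (is_Cderive_mult _ _ z _ _ H2 (is_Cderive_const (/ 2) z)) as H3.
  cbv beta in H3.
  replace ((Cexp z + Cexp (- z)) / 2)
    with ((Cexp z - - (1) * Cexp (- z)) * / 2 + (Cexp z - Cexp (- z)) * 0)
    by (unfold Cdiv; ring).
  exact H3.
Qed.

(** |sinh (x + i y)|^2 = sinh^2 x + sin^2 y, and each summand is at most the square of the
    corresponding coordinate divided by [arcsinh 1]. *)
Lemma Cmod_Csinh_le (u : C) :
  (Cmod u <= arcsinh 1)%R -> (Cmod (Csinh u) <= Cmod u / arcsinh 1)%R.
Proof.
  intros Hu. pose proof arcsinh_1_pos as Ha. pose proof arcsinh_1_le_1 as Ha1.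
  pose proof (Cmod_ge_0 u) as Hu0. pose proof (re_le_Cmod u) as Hre.
  pose proof (Cmod2_alt u) as E.
  pose proof (Cmod2_alt (Csinh u)) as Es. pose proof (Cmod_ge_0 (Csinh u)) as Hs0.
  destruct u as [x y]. set (s := Cmod (Csinh (x, y))) in *.
  rewrite Csinh_components in Es.
  unfold Re, Im in *; simpl fst in *; simpl snd in *.
  set (m := Cmod (x, y)) in *.
  set (a := arcsinh 1) in *.
  pose proof (Rabs_sinh_le x (Rle_trans _ _ _ Hre Hu)) as H1. fold a in H1.
  pose proof (Rabs_sin_le y) as H2.
  assert (H3 : (Rabs y <= Rabs y / a)%R).
  { apply (Rmult_le_reg_r a); [exact Ha|].
    replace (Rabs y / a * a)%R with (Rabs y) by (field; lra).
    pose proof (Rabs_pos y). nra. }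
  assert (S1 : (sinh x ^ 2 <= (x / a) ^ 2)%R).
  { rewrite <- (pow2_abs (sinh x)), <- (pow2_abs (x / a)).
    apply pow_incr. split; [apply Rabs_pos|].
    unfold Rdiv. rewrite Rabs_mult, Rabs_inv, (Rabs_pos_eq a) by lra. exact H1. }
  assert (S2 : (sin y ^ 2 <= (y / a) ^ 2)%R).
  { rewrite <- (pow2_abs (sin y)), <- (pow2_abs (y / a)).
    apply pow_incr. split; [apply Rabs_pos|].
    unfold Rdiv. rewrite Rabs_mult, Rabs_inv, (Rabs_pos_eq a) by lra.
    unfold Rdiv in H3. lra. }
  assert (Hm : (0 <= m / a)%R)
    by (apply Rmult_le_pos; [lra | left; apply Rinv_0_lt_compat; lra]).
  assert (Hsq : (s ^ 2 <= (m / a) ^ 2)%R).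
  { replace ((m / a) ^ 2)%R with ((x / a) ^ 2 + (y / a) ^ 2)%R.
    - rewrite Es.
      replace ((sinh x * cos y) ^ 2 + (cosh x * sin y) ^ 2)%R
        with (sinh x ^ 2 * (1 - sin y ^ 2) + cosh x ^ 2 * sin y ^ 2)%R.
      + pose proof (cosh2_minus_sinh2 x). nra.
      + pose proof (sin2_cos2 y) as T. unfold Rsqr in T. nra.
    - replace ((m / a) ^ 2)%R with (m ^ 2 / a ^ 2)%R by (field; lra).
      rewrite E. field. lra. }
  apply Rnot_lt_le. intros Hlt. nra.
Qed.

Lemma Csqrt_sqr (c : C) : (0 < Re c)%R -> Csqrt (c * c) = c.
Proof.
  destruct c as [x y]. unfold Re; simpl fst. intros Hx.
  unfold Csqrt. rewrite Cmod_mult.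
  pose proof (Cmod2_alt (x, y)) as E. unfold Re, Im in E; simpl fst in E; simpl snd in E.
  replace (Cmod (x, y) * Cmod (x, y))%R with (x ^ 2 + y ^ 2)%R by lra.
  unfold Re, Im, Cmult; simpl fst; simpl snd.
  replace ((x ^ 2 + y ^ 2 + (x * x - y * y)) / 2)%R with (Rsqr x)
    by (unfold Rsqr; field).
  replace ((x ^ 2 + y ^ 2 - (x * x - y * y)) / 2)%R with (Rsqr y)
    by (unfold Rsqr; field).
  rewrite !sqrt_Rsqr_abs, (Rabs_pos_eq x) by lra.
  (* Im (c^2) = 2 x y has the sign of y because x > 0, so the branch test recovers the sign of y. *)
  f_equal. destruct (Rlt_dec (x * y + y * x) 0) as [H|H].
  - rewrite Rabs_left by nra. ring.
  - apply Rabs_pos_eq. nra.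
Qed.

Lemma Clog_Cexp (z : C) : (- PI < Im z < PI)%R -> Clog (Cexp z) = z.
Proof.
  intros Hz. unfold Clog, Carg. rewrite Cmod_Cexp, ln_exp.
  destruct z as [x y]. unfold Cexp, Re, Im in *. simpl fst in *. simpl snd in *.
  pose proof (exp_pos x) as Hx. f_equal.
  replace (exp x * cos y / exp x)%R with (cos y) by (field; lra).
  destruct (Rlt_dec (exp x * sin y) 0) as [H|H].
  - assert (Hy : (y < 0)%R).
    { apply Rnot_le_lt. intros Hy.
      pose proof (sin_ge_0 y Hy ltac:(lra)). nra. }
    rewrite <- (cos_neg y), acos_cos by lra. ring.
  - assert (Hy : (0 <= y)%R).
    { apply Rnot_lt_le. intros Hy.
      pose proof (sin_gt_0 (- y) ltac:(lra) ltac:(lra)) as P. rewrite sin_neg in P.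
      apply H. nra. }
    apply acos_cos. lra.
Qed.

(** 1 + sinh^2 u = cosh^2 u, and Re (cosh u) = cosh x cos y > 0 in this strip, so the principal root
    is cosh u. Then sinh u + cosh u = exp u, which the principal logarithm inverts. *)
Lemma Carcsinh_Csinh (u : C) :
  (- (PI / 2) < Im u < PI / 2)%R -> Carcsinh (Csinh u) = u.
Proof.
  intros Hu. unfold Carcsinh.
  assert (EE : Cexp u * Cexp (- u) = 1)
    by (rewrite <- Cexp_plus, <- Cexp_0; f_equal; ring).
  set (c := (Cexp u + Cexp (- u)) / 2).
  assert (Ec : 1 + Csinh u * Csinh u = c * c).
  { unfold c, Csinh. rewrite <- EE. field. }
  rewrite Ec, Csqrt_sqr.
  - replace (Csinh u + c) with (Cexp u) by (unfold Csinh, c; field).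
    apply Clog_Cexp. pose proof PI_RGT_0. lra.
  - replace (Re c) with (cosh (Re u) * cos (Im u))%R.
    + apply Rmult_lt_0_compat.
      * pose proof (cosh_ge_1 (Re u)). lra.
      * apply cos_gt_0; lra.
    + unfold c, Cdiv.
      rewrite <- RtoC_inv by lra.
      destruct u as [x y].
      unfold Cexp, cosh, Cplus, Copp, Cmult, RtoC, Re, Im; simpl.
      rewrite cos_neg, sin_neg. field.
Qed.

Lemma Cmod_Csqrt (w : C) : Cmod (Csqrt w) = sqrt (Cmod w).
Proof.
  pose proof (re_le_Cmod w) as H. apply Rabs_le_between in H.
  unfold Csqrt. unfold Cmod at 1. simpl fst. simpl snd. f_equal.
  assert (N : forall r : R, ((- r) ^ 2 = r ^ 2)%R) by (intros; ring).
  destruct (Rlt_dec (Im w) 0) as [_|_]; rewrite ?N, !pow2_sqrt by lra; field.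
Qed.

(** The real part is ln |w + sqrt (1 + w^2)|, and the triangle inequality bounds the modulus
    strictly by 1 + sqrt 2. *)
Lemma Re_Carcsinh_lt (w : C) : in_disk w -> (Re (Carcsinh w) < arcsinh 1)%R.
Proof.
  intros Hw. unfold in_disk in Hw. unfold Carcsinh, Clog, Re; simpl fst.
  set (v := w + Csqrt (1 + w * w)).
  assert (Hv : (Cmod v < 1 + sqrt (1 ^ 2 + 1))%R).
  { eapply Rle_lt_trans; [apply Cmod_triangle|]. rewrite Cmod_Csqrt.
    apply Rplus_lt_le_compat; [exact Hw|]. apply sqrt_le_1_alt.
    eapply Rle_trans; [apply Cmod_triangle|]. rewrite Cmod_1, Cmod_mult.
    pose proof (Cmod_ge_0 w). nra. }
  (* At modulus 0 the total function [ln] takes its default value 0, which is also below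
     [arcsinh 1]. *)
  destruct (Req_dec (Cmod v) 0) as [E|E].
  - rewrite E. unfold ln. destruct Rlt_dec as [H|_]; [exfalso; exact (Rlt_irrefl _ H)|].
    exact arcsinh_1_pos.
  - pose proof (Cmod_ge_0 v). unfold arcsinh. apply ln_increasing; lra.
Qed.

(** * Dilations of functions in the class S_n *)

Lemma power_series_at_0 (a : nat -> C) (f : C -> C) :
  power_series_on_disk a f -> f 0 = a 0%nat.
Proof.
  intros Hf.
  destruct (bounded_in_disk_power_series (fun k => a (S k))) as [q Hq].
  { apply bounded_in_disk_shift. eapply power_series_bounded, Hf. }
  assert (H0 : in_disk 0) by (unfold in_disk; rewrite Cmod_0; lra).
  rewrite (power_series_unique a f _ 0 Hf (power_series_shift a q Hq) H0). ring.
Qed.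

Lemma in_disk_neq_1 (w : C) : in_disk w -> 1 - w <> 0.
Proof.
  intros Hw E. unfold in_disk in Hw.
  replace w with (RtoC 1) in Hw by (rewrite <- (Cplus_0_r w), <- E; ring).
  rewrite Cmod_1 in Hw. lra.
Qed.

Lemma Re_cayley_pos (w : C) : in_disk w -> (0 < Re ((1 + w) / (1 - w)))%R.
Proof.
  intros Hw. pose proof (in_disk_neq_1 w Hw) as Hne. apply Cmod_gt_0 in Hne.
  pose proof (Cmod2_alt (1 - w)) as E1. pose proof (Cmod2_alt w) as E2.
  unfold in_disk in Hw. pose proof (Cmod_ge_0 w) as Hw0.
  set (m := Cmod (1 - w)) in *. set (r := Cmod w) in *.
  destruct w as [x y].
  unfold Re, Im, Cminus, Cplus, Copp, RtoC in E1, E2. simpl fst in *. simpl snd in *.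
  assert (D : (0 < (1 + - x) ^ 2 + (0 + - y) ^ 2)%R)
    by (rewrite <- E1; apply pow_lt, Hne).
  replace (Re ((1 + (x, y)) / (1 - (x, y))))
    with ((1 - r ^ 2) / ((1 + - x) ^ 2 + (0 + - y) ^ 2))%R.
  - apply Rdiv_lt_0_compat; [nra | exact D].
  - rewrite E2. unfold Re, Cdiv, Cinv, Cmult, Cminus, Cplus, Copp, RtoC; simpl fst; simpl snd.
    field. lra.
Qed.

Lemma is_Cderive_ext (f g : C -> C) (z d : C) :
  (forall w, f w = g w) -> is_Cderive f z d -> is_Cderive g z d.
Proof. exact (@is_derive_ext C_AbsRing C_NormedModule f g z d). Qed.

Lemma is_Cderive_ex (f : C -> C) (z d : C) :
  is_Cderive f z d -> @ex_derive C_AbsRing C_NormedModule f z.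
Proof. intros H. exists d. exact H. Qed.

Lemma in_disk_scal (r : R) (z : C) :
  (0 < r <= 1)%R -> in_disk z -> in_disk (RtoC r * z).
Proof.
  intros Hr Hz. unfold in_disk in *. rewrite Cmod_mult, Cmod_R, Rabs_pos_eq by lra.
  pose proof (Cmod_ge_0 z). nra.
Qed.

Lemma RtoC_neq_0 (r : R) : r <> 0%R -> RtoC r <> 0.
Proof. intros H E. apply RtoC_inj in E. contradiction. Qed.

Lemma quotient_by_id_spec (g : C -> C) (w : C) :
  g 0 = 0 -> w * quotient_by_id g w = g w.
Proof.
  intros H0. unfold quotient_by_id. destruct (Ceq_dec w 0) as [->|Hw].
  - rewrite H0. ring.
  - field. exact Hw.
Qed.

(** Two indices, because [class_Srho_n n] asks for membership both in [class_A n] and, through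
    [class_Srho], in [class_A 1]. *)
Lemma class_A_dilation (m n : nat) (r : R) (g : C -> C) :
  (m <= n)%nat -> (0 < r <= 1)%R -> class_A n g -> class_A m (dilation r g).
Proof.
  intros Hmn Hr (Han & a & Ha0 & Ha1 & Hak & Hps).
  pose proof (RtoC_neq_0 r ltac:(lra)) as Hr0.
  split.
  - intros z Hz. destruct (Han _ (in_disk_scal r z Hr Hz)) as [d Hd].
    change (is_Cderive g (RtoC r * z) d) in Hd.
    apply (is_Cderive_ex _ _ (0 * g (RtoC r * z) + RtoC (/ r) * ((0 * z + RtoC r * 1) * d))).
    apply (is_Cderive_mult (fun _ => RtoC (/ r)) (fun w => g (RtoC r * w)));
      [apply is_Cderive_const|].
    apply is_Cderive_comp; [exact Hd|].
    apply (is_Cderive_mult (fun _ => RtoC r) (fun w => w));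
      [apply is_Cderive_const | apply is_Cderive_id].
  - exists (fun k => RtoC (/ r) * (RtoC r ^ k * a k)). repeat split.
    + rewrite Ha0. ring.
    + rewrite Ha1, RtoC_inv by lra. rewrite Cpow_1_r. field. exact Hr0.
    + intros k Hk. rewrite Hak by lia. ring.
    + intros z Hz. pose proof (Hps _ (in_disk_scal r z Hr Hz)) as H.
      apply is_Cpseries_iff in H. apply is_Cpseries_iff.
      apply (@is_series_scal C_AbsRing C_NormedModule (RtoC (/ r))) in H.
      refine (@is_series_ext C_AbsRing C_NormedModule _ _ _ _ H).
      intros k. change (RtoC (/ r) * (a k * (RtoC r * z) ^ k)
                        = RtoC (/ r) * (RtoC r ^ k * a k) * z ^ k).
      rewrite Cpow_mult_l. ring.
Qed.

(** The logarithmic derivative of w p(w), taken at w = r z; the outer factor 1/r cancels in the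
    quotient. *)
Lemma starlike_quotient_dilation (g p dp : C -> C) (r : R) (z : C) :
  (forall w, w * p w = g w) -> (0 < r <= 1)%R -> in_disk z -> z <> 0 ->
  is_Cderive p (RtoC r * z) (dp (RtoC r * z)) -> p (RtoC r * z) <> 0 ->
  starlike_quotient (dilation r g) z
  = 1 + RtoC r * z * dp (RtoC r * z) / p (RtoC r * z).
Proof.
  intros Hg Hr Hz Hz0 Hdp Hp0.
  pose proof (RtoC_neq_0 r ltac:(lra)) as Hr0.
  unfold starlike_quotient. destruct (Ceq_dec z 0) as [E|_]; [contradiction|].
  set (w := RtoC r * z) in *.
  assert (Dg : is_Cderive g w (1 * p w + w * dp w)).
  { apply (is_Cderive_ext (fun v => v * p v)); [exact Hg|].
    apply (is_Cderive_mult (fun v => v)); [apply is_Cderive_id | exact Hdp]. }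
  assert (Dd : is_Cderive (dilation r g) z (p w + w * dp w)).
  { replace (p w + w * dp w)
      with (0 * g w + RtoC (/ r) * ((0 * z + RtoC r * 1) * (1 * p w + w * dp w)))
      by (rewrite RtoC_inv by lra; field; exact Hr0).
    apply (is_Cderive_mult (fun _ => RtoC (/ r)) (fun v => g (RtoC r * v)));
      [apply is_Cderive_const|].
    apply is_Cderive_comp; [exact Dg|].
    apply (is_Cderive_mult (fun _ => RtoC r) (fun v => v));
      [apply is_Cderive_const | apply is_Cderive_id]. }
  rewrite (is_C_derive_unique _ _ _ Dd). unfold dilation. fold w. rewrite <- (Hg w).
  rewrite RtoC_inv by lra. unfold w in *. field.
  repeat split; assumption.
Qed.

(** t is the positive root of a t^2 + 2 n t - a = 0, written with the square root rationalized into
    the denominator. *)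
Lemma radius_equation (n a : R) :
  (0 < n)%R -> (0 < a)%R ->
  let t := (a / (n + sqrt (n ^ 2 + a ^ 2)))%R in
  (0 < t < 1)%R /\ (2 * n * t = a * (1 - t ^ 2))%R.
Proof.
  intros Hn Ha t.
  set (q := sqrt (n ^ 2 + a ^ 2)) in *.
  assert (Hq2 : (q ^ 2 = n ^ 2 + a ^ 2)%R) by (apply pow2_sqrt; nra).
  assert (Hq : (0 <= q)%R) by apply sqrt_pos.
  assert (Hqa : (a < q)%R) by (apply Rnot_le_lt; intros H; nra).
  split; [split|].
  - apply Rdiv_lt_0_compat; lra.
  - unfold t. apply (Rmult_lt_reg_r (n + q)); [lra|]. unfold Rdiv.
    rewrite Rmult_assoc, Rinv_l by lra. lra.
  - unfold t. apply (Rmult_eq_reg_r ((n + q) ^ 2)); [|apply pow_nonzero; lra].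
    field_simplify; [|lra|lra]. nra.
Qed.

Lemma Rpower_root_pow (t : R) (n : nat) :
  (1 <= n)%nat -> (0 < t)%R -> (Rpower t (1 / INR n) ^ n = t)%R.
Proof.
  intros Hn Ht. assert (0 < INR n)%R by (apply lt_0_INR; lia).
  rewrite <- Rpower_pow by apply exp_pos. rewrite Rpower_mult.
  replace (1 / INR n * INR n)%R with 1%R by (field; lra). apply Rpower_1, Ht.
Qed.

Lemma pow_lt_1_inv (x : R) (n : nat) : (0 <= x)%R -> (x ^ n < 1)%R -> (x < 1)%R.
Proof.
  intros Hx H. apply Rnot_le_lt. intros H1. pose proof (pow_R1_Rle x n H1). lra.
Qed.

Lemma pow_le_self (x : R) (n : nat) : (1 <= n)%nat -> (0 <= x <= 1)%R -> (x ^ n <= x)%R.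
Proof.
  intros Hn Hx. destruct n as [|n]; [lia|]. simpl.
  pose proof (pow_incr x 1 n Hx) as H. rewrite pow1 in H. nra.
Qed.

(** The derivative [d2] of z p' is carried along so that z p'/p can be shown analytic later. *)
Lemma class_S_quotient (n : nat) (g : C -> C) :
  (1 <= n)%nat -> class_S n g ->
  exists p dp d2 : C -> C,
    (forall w, w * p w = g w) /\
    (forall w, in_disk w -> is_Cderive p w (dp w)) /\
    (forall w, in_disk w -> is_Cderive (fun v => v * dp v) w (d2 w)) /\
    (forall w, in_disk w -> (0 < Re (p w))%R) /\
    (forall w, in_disk w ->
      (Cmod (w * dp w) * (1 - (Cmod w ^ n) ^ 2)
       <= 2 * INR n * Cmod w ^ n * Re (p w))%R).
Proof.
  intros Hn ((_ & a & Ha0 & _ & _ & Hga) & _ & (c & _ & Hck & Hpc) &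
             (om & _ & _ & Hom & Hsub)).
  destruct (power_series_derive _ _ Hpc) as (dp & Hdp & Hpe).
  destruct (power_series_derive _ _ Hpe) as (d2 & Hd2 & _).
  assert (Hpos : forall w, in_disk w -> (0 < Re (quotient_by_id g w))%R).
  { intros w Hw. rewrite Hsub by exact Hw. apply Re_cayley_pos.
    unfold in_disk in *. specialize (Hom w Hw). lra. }
  exists (quotient_by_id g), dp, d2. split; [|split; [exact Hdp | split; [exact Hd2 | split; [exact Hpos|]]]].
  - intros w. apply quotient_by_id_spec. rewrite (power_series_at_0 a g Hga). exact Ha0.
  - exact (positive_real_part_gradient_bound n c _ dp Hn Hck Hpc Hdp Hpe Hpos).
Qed.

Lemma class_S_dilation_Srho (n : nat) (g : C -> C) (r : R) :
  (1 <= n)%nat -> class_S n g -> (0 < r < 1)%R ->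
  (2 * INR n * r ^ n <= arcsinh 1 * (1 - (r ^ n) ^ 2))%R ->
  class_Srho_n n (dilation r g).
Proof.
  intros Hn Hg Hr Hbound.
  assert (Hr' : (0 < r <= 1)%R) by lra.
  destruct (class_S_quotient n g Hn Hg) as (p & dp & d2 & Hpg & Hdp & Hd2 & Hpos & Hgrad).
  destruct Hg as [HA _].
  assert (Hp0 : forall w, in_disk w -> p w <> 0).
  { intros w Hw E. specialize (Hpos w Hw). rewrite E in Hpos. simpl in Hpos. lra. }
  set (u := fun z => RtoC r * z * dp (RtoC r * z) / p (RtoC r * z)).
  assert (Hin : forall z, in_disk z -> in_disk (RtoC r * z))
    by (intros z Hz; apply in_disk_scal; assumption).
  pose proof arcsinh_1_pos as Ha. pose proof arcsinh_1_le_1 as Ha1.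
  assert (Hn0 : (0 < INR n)%R) by (apply lt_0_INR; lia).
  assert (Hu : forall z, in_disk z -> (Cmod (u z) <= arcsinh 1 * Cmod z)%R).
  { intros z Hz. unfold u. rewrite Cmod_div by (apply Hp0, Hin, Hz).
    specialize (Hgrad _ (Hin z Hz)). specialize (Hpos _ (Hin z Hz)).
    pose proof (re_le_Cmod (p (RtoC r * z))) as Hre. rewrite Rabs_pos_eq in Hre by lra.
    rewrite (Cmod_mult (RtoC r) z), Cmod_R, (Rabs_pos_eq r), Rpow_mult_distr in Hgrad by lra.
    unfold in_disk in Hz. pose proof (Cmod_ge_0 z) as Hz0.
    pose proof (pow_le_self (Cmod z) n Hn ltac:(lra)) as Hzn.
    pose proof (pow_le (Cmod z) n Hz0) as Hzn0.
    pose proof (pow_lt r n ltac:(lra)) as Hrn0.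
    pose proof (pow_le_self r n Hn ltac:(lra)) as Hrn1.
    set (G := Cmod (RtoC r * z * dp (RtoC r * z))) in *.
    set (P := Cmod (p (RtoC r * z))) in *. set (v := Re (p (RtoC r * z))) in *.
    set (t := (r ^ n)%R) in *. set (x := (Cmod z ^ n)%R) in *. set (m := Cmod z) in *.
    set (a := arcsinh 1) in *.
    assert (HG : (0 <= G)%R) by apply Cmod_ge_0.
    assert (HD : (0 < 1 - t ^ 2)%R) by nra.
    assert (HD2 : (1 - t ^ 2 <= 1 - (t * x) ^ 2)%R).
    { assert (0 <= t * x <= t)%R by nra. nra. }
    assert (K1 : (G * (1 - t ^ 2) <= 2 * INR n * (t * x) * P)%R).
    { apply Rle_trans with (G * (1 - (t * x) ^ 2))%R; [apply Rmult_le_compat_l; lra|].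
      eapply Rle_trans; [exact Hgrad|]. apply Rmult_le_compat_l; [|exact Hre].
      apply Rmult_le_pos; [lra | apply Rmult_le_pos; lra]. }
    (* Only the denominator was estimated at |z| = 1. The factor x = |z|^n <= |z| kept in the
       numerator becomes the factor |z| that a subordinating map must have. *)
    assert (K2 : (2 * INR n * (t * x) * P <= a * m * P * (1 - t ^ 2))%R).
    { apply Rle_trans with (a * (1 - t ^ 2) * x * P)%R.
      - replace (2 * INR n * (t * x) * P)%R with (2 * INR n * t * (x * P))%R by ring.
        replace (a * (1 - t ^ 2) * x * P)%R with (a * (1 - t ^ 2) * (x * P))%R by ring.
        apply Rmult_le_compat_r; [apply Rmult_le_pos; lra | exact Hbound].
      - replace (a * (1 - t ^ 2) * x * P)%R with (a * (1 - t ^ 2) * P * x)%R by ring.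
        replace (a * m * P * (1 - t ^ 2))%R with (a * (1 - t ^ 2) * P * m)%R by ring.
        apply Rmult_le_compat_l; [|exact Hzn].
        apply Rmult_le_pos; [apply Rmult_le_pos; lra | lra]. }
    apply (Rmult_le_reg_r P); [lra|].
    replace (G / P * P)%R with G by (field; lra).
    apply (Rmult_le_reg_r (1 - t ^ 2)); [exact HD|]. lra. }
  split; [apply (class_A_dilation n n r g); [lia | exact Hr' | exact HA]|].
  split; [apply (class_A_dilation 1 n r g); [lia | exact Hr' | exact HA]|].
  split.
  { intros z Hz Hz0. unfold dilation. rewrite <- Hpg.
    repeat apply Cmult_neq_0; try (apply RtoC_neq_0; lra); try assumption.
    - apply RtoC_neq_0. apply Rinv_neq_0_compat. lra.
    - apply Hp0, Hin, Hz. }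
  exists (fun z => Csinh (u z)). split; [|split; [|split]].
  - intros z Hz.
    assert (HL : is_Cderive (fun w => RtoC r * w) z (0 * z + RtoC r * 1))
      by (apply (is_Cderive_mult (fun _ => RtoC r) (fun w => w));
          [apply is_Cderive_const | apply is_Cderive_id]).
    eapply is_Cderive_ex.
    apply (is_Cderive_comp Csinh u); [apply is_Cderive_Csinh|].
    apply (is_Cderive_div (fun w => RtoC r * w * dp (RtoC r * w)) (fun w => p (RtoC r * w))).
    + apply (is_Cderive_comp (fun v => v * dp v) (fun w => RtoC r * w));
        [apply Hd2, Hin, Hz | exact HL].
    + apply (is_Cderive_comp p (fun w => RtoC r * w)); [apply Hdp, Hin, Hz | exact HL].
    + apply Hp0, Hin, Hz.
  - unfold u, Csinh, Cdiv. rewrite !Cmult_0_r, !Cmult_0_l.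
    replace (- 0) with (RtoC 0) by ring. ring.
  - intros z Hz. specialize (Hu z Hz). unfold in_disk in Hz.
    pose proof (Cmod_ge_0 z). pose proof (Cmod_ge_0 (u z)).
    eapply Rle_trans; [apply Cmod_Csinh_le; nra|].
    apply (Rmult_le_reg_r (arcsinh 1)); [exact Ha|].
    replace (Cmod (u z) / arcsinh 1 * arcsinh 1)%R with (Cmod (u z)) by (field; lra). lra.
  - intros z Hz. rewrite Carcsinh_Csinh.
    + destruct (Ceq_dec z 0) as [->|Hz0].
      * unfold starlike_quotient. destruct (Ceq_dec 0 0) as [_|N]; [|contradiction].
        unfold u, Cdiv. rewrite !Cmult_0_r, !Cmult_0_l. ring.
      * apply starlike_quotient_dilation; auto.
    (* |Im u| <= |u| <= [arcsinh 1] <= 1 < pi / 2, so u lies in the strip where sinh is inverted. *)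
    + specialize (Hu z Hz). unfold in_disk in Hz.
      pose proof (Cmod_ge_0 z).
      assert (HI : (Rabs (Im (u z)) <= Cmod (u z))%R)
        by (eapply Rle_trans; [apply Rmax_r | apply Rmax_Cmod]).
      apply Rabs_le_between in HI.
      pose proof PI2_1. nra.
Qed.

(** * The extremal function and sharpness *)

Definition extremal_quotient (n : nat) (z : C) : C := (1 + z ^ n) / (1 - z ^ n).

Definition extremal_function (n : nat) (z : C) : C := z * extremal_quotient n z.

(** The expansion 1 + 2 z^n + 2 z^(2n) + ...; the index 0 is tested before divisibility, since it
    too is a multiple of n. *)
Definition extremal_coeff (n k : nat) : C :=
  if Nat.eq_dec k 0 then 1
  else if Nat.eq_dec (k mod n) 0 then 2 else 0.

Lemma in_disk_pow (n : nat) (z : C) : (1 <= n)%nat -> in_disk z -> in_disk (z ^ n).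
Proof.
  unfold in_disk. intros Hn Hz. rewrite Cmod_pow. pose proof (Cmod_ge_0 z).
  pose proof (pow_le_self (Cmod z) n Hn ltac:(lra)). lra.
Qed.

Lemma power_series_ext (a b : nat -> C) (f g : C -> C) :
  (forall k, a k = b k) -> (forall z, in_disk z -> f z = g z) ->
  power_series_on_disk a f -> power_series_on_disk b g.
Proof.
  intros Hab Hfg Hf z Hz. rewrite <- (Hfg z Hz). specialize (Hf z Hz).
  apply is_Cpseries_iff in Hf. apply is_Cpseries_iff.
  refine (@is_series_ext C_AbsRing C_NormedModule _ _ _ _ Hf).
  intros k. rewrite Hab. reflexivity.
Qed.

(* The tail [b_k = extremal_coeff (S k)] sums to [q] with [z q z = z^n (2 + z q z)],
   because the coefficients become [n]-periodic once the zeroth one is replaced by 2. *)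
Lemma extremal_quotient_power_series (n : nat) :
  (1 <= n)%nat -> power_series_on_disk (extremal_coeff n) (extremal_quotient n).
Proof.
  intros Hn.
  assert (Hb : bounded_in_disk (extremal_coeff n)).
  { intros rho Hrho. exists 2%R. intros k.
    assert (Hc : (Cmod (extremal_coeff n k) <= 2)%R).
    { unfold extremal_coeff. destruct Nat.eq_dec; [rewrite Cmod_1; lra|].
      destruct Nat.eq_dec; rewrite Cmod_R, Rabs_pos_eq; lra. }
    pose proof (pow_incr rho 1 k ltac:(lra)) as Hp. rewrite pow1 in Hp.
    pose proof (pow_le rho k ltac:(lra)). pose proof (Cmod_ge_0 (extremal_coeff n k)).
    nra. }
  destruct (bounded_in_disk_power_series _ (bounded_in_disk_shift _ Hb)) as [q Hq].
  pose proof (power_series_shift (extremal_coeff n) q Hq) as HP.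
  (* The same coefficients with constant term c. For c = 0 the first n of them vanish, and dropping
     these n leaves the sequence for c = 2. *)
  set (b0 := fun (c : C) (k : nat) => match k with O => c | S k => extremal_coeff n (S k) end).
  assert (Hb0 : forall c, power_series_on_disk (b0 c) (fun z => c + z * q z)).
  { intros c. exact (power_series_shift (b0 c) q Hq). }
  destruct (power_series_factor n (b0 0) _ (Hb0 0)) as (q2 & Hq2 & E).
  { intros [|k] Hk; [reflexivity|]. simpl. unfold extremal_coeff.
    destruct Nat.eq_dec; [lia|]. rewrite Nat.mod_small by lia.
    destruct Nat.eq_dec; [lia | reflexivity]. }
  assert (Hq2' : forall z, in_disk z -> q2 z = 2 + z * q z).
  { intros z Hz. refine (power_series_unique _ _ _ z _ (Hb0 2) Hz).
    refine (power_series_ext _ _ _ _ _ (fun _ _ => eq_refl) Hq2).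
    intros k. destruct n as [|n]; [lia|]. simpl. unfold extremal_coeff.
    destruct k as [|k]; simpl b0.
    - rewrite Nat.add_0_r. destruct Nat.eq_dec; [lia|].
      rewrite Nat.Div0.mod_same. destruct Nat.eq_dec; [reflexivity | contradiction].
    - unfold extremal_coeff. destruct Nat.eq_dec; [lia|].
      replace (S (n + S k)) with (S k + 1 * S n)%nat by lia.
      rewrite Nat.Div0.mod_add. destruct (Nat.eq_dec (S k) 0); [lia | reflexivity]. }
  refine (power_series_ext _ _ _ _ (fun _ => eq_refl) _ HP).
  intros z Hz. specialize (E z Hz). rewrite Hq2' in E by exact Hz.
  pose proof (in_disk_neq_1 _ (in_disk_pow n z Hn Hz)) as Hne.
  unfold extremal_coeff, extremal_quotient. simpl Nat.eq_dec. cbv iota beta.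
  replace (z * q z) with (2 * z ^ n / (1 - z ^ n)); [field; exact Hne|].
  replace (2 * z ^ n) with (z * q z * (1 - z ^ n)); [field; exact Hne|].
  transitivity (0 + z * q z - z ^ n * (z * q z)); [ring|]. rewrite E at 1. ring.
Qed.

Lemma is_Cderive_extremal_quotient (n : nat) (z : C) :
  (1 <= n)%nat -> in_disk z ->
  is_Cderive (extremal_quotient n) z
    (2 * INR n * z ^ pred n / ((1 - z ^ n) * (1 - z ^ n))).
Proof.
  intros Hn Hz. pose proof (in_disk_neq_1 _ (in_disk_pow n z Hn Hz)) as Hne.
  pose proof (is_Cderive_pow n z) as Hp.
  replace (2 * INR n * z ^ pred n / ((1 - z ^ n) * (1 - z ^ n)))
    with (((0 + INR n * z ^ pred n) * (1 - z ^ n)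
           - (1 + z ^ n) * (0 - INR n * z ^ pred n)) / ((1 - z ^ n) * (1 - z ^ n)))
    by (field; exact Hne).
  apply (is_Cderive_div (fun w => 1 + w ^ n) (fun w => 1 - w ^ n)); [| |exact Hne].
  - apply is_Cderive_plus; [apply is_Cderive_const | exact Hp].
  - apply is_Cderive_minus; [apply is_Cderive_const | exact Hp].
Qed.

Lemma quotient_by_id_extremal (n : nat) (z : C) :
  (1 <= n)%nat -> quotient_by_id (extremal_function n) z = extremal_quotient n z.
Proof.
  intros Hn. unfold quotient_by_id, extremal_function.
  destruct (Ceq_dec z 0) as [->|Hz].
  - unfold extremal_quotient. destruct n as [|n]; [lia|]. rewrite Cpow_S.
    replace (0 * 0 ^ n) with (RtoC 0) by ring. field.
  - field. exact Hz.
Qed.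

Lemma class_S_extremal (n : nat) : (1 <= n)%nat -> class_S n (extremal_function n).
Proof.
  intros Hn. pose proof (extremal_quotient_power_series n Hn) as Hps.
  assert (Hc : forall k, (1 <= k < n)%nat -> extremal_coeff n k = 0).
  { intros k Hk. unfold extremal_coeff. destruct Nat.eq_dec; [lia|].
    rewrite Nat.mod_small by lia. destruct Nat.eq_dec; [lia | reflexivity]. }
  split; [split|split; [|split]].
  - intros z Hz. eapply is_Cderive_ex.
    apply (is_Cderive_mult (fun w => w));
      [apply is_Cderive_id | apply is_Cderive_extremal_quotient; assumption].
  - exists (fun k => match k with O => RtoC 0 | S k => extremal_coeff n k end).
    split; [reflexivity|]. split; [reflexivity|]. split.
    + intros [|k] Hk; [lia|]. apply Hc. lia.
    + refine (power_series_ext _ _ _ _ (fun _ => eq_refl) _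
                (power_series_shift (fun k => match k with O => RtoC 0 | S k => extremal_coeff n k end)
                   _ Hps)).
      intros z _. unfold extremal_function. ring.
  - intros z Hz. eapply is_Cderive_ex.
    apply (is_Cderive_ext (extremal_quotient n));
      [intros w; symmetry; apply quotient_by_id_extremal, Hn|].
    apply is_Cderive_extremal_quotient; assumption.
  - exists (extremal_coeff n). split; [reflexivity|]. split; [exact Hc|].
    refine (power_series_ext _ _ _ _ (fun _ => eq_refl) _ Hps).
    intros z _. symmetry. apply quotient_by_id_extremal, Hn.
  - exists (fun z => z ^ n). split; [|split; [|split]].
    + intros z _. eapply is_Cderive_ex, is_Cderive_pow.
    + destruct n as [|n]; [lia|]. rewrite Cpow_S. ring.
    + intros z Hz. rewrite Cmod_pow. apply pow_le_self; [exact Hn|].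
      unfold in_disk in Hz. pose proof (Cmod_ge_0 z). lra.
    + intros z _. apply quotient_by_id_extremal, Hn.
Qed.

(** Dilation by r > r0 brings the critical point r0 to r0 / r, inside the disk. Subordination would
    then write [arcsinh 1] as the arcsinh of some w with |w| < 1, against the strict bound on the
    real part. *)
Lemma extremal_not_Srho (n : nat) (r0 r : R) :
  (1 <= n)%nat -> (0 < r0 < r)%R -> (r <= 1)%R ->
  (2 * INR n * r0 ^ n = arcsinh 1 * (1 - (r0 ^ n) ^ 2))%R ->
  ~ class_Srho (dilation r (extremal_function n)).
Proof.
  intros Hn Hr0 Hr Heq (_ & _ & om & _ & _ & Hom & Hsub).
  set (x := (r0 / r)%R).
  assert (Hx : (0 < x < 1)%R).
  { unfold x. split; [apply Rdiv_lt_0_compat; lra|].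
    apply (Rmult_lt_reg_r r); [lra|]. unfold Rdiv. rewrite Rmult_assoc, Rinv_l; lra. }
  assert (Hz : in_disk (RtoC x)) by (unfold in_disk; rewrite Cmod_R, Rabs_pos_eq; lra).
  assert (Hw : in_disk (RtoC r0)) by (unfold in_disk; rewrite Cmod_R, Rabs_pos_eq; lra).
  assert (Erx : RtoC r * RtoC x = RtoC r0)
    by (rewrite <- RtoC_mult; f_equal; unfold x; field; lra).
  specialize (Hom _ Hz). specialize (Hsub _ Hz).
  assert (Hin : in_disk (om (RtoC x))).
  { unfold in_disk. rewrite Cmod_R, Rabs_pos_eq in Hom by lra. lra. }
  pose proof (Re_Carcsinh_lt _ Hin) as Hlt.
  pose proof (in_disk_neq_1 _ (in_disk_pow n _ Hn Hw)) as Hne.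
  set (t := (r0 ^ n)%R) in *.
  assert (Ht : (0 < t <= r0)%R)
    by (split; [apply pow_lt; lra | apply pow_le_self; [exact Hn | lra]]).
  assert (EW : RtoC r0 ^ n = RtoC t) by (symmetry; apply RtoC_pow).
  assert (Hne2 : 1 + RtoC t <> 0)
    by (rewrite <- RtoC_plus; apply RtoC_neq_0; lra).
  rewrite EW in Hne.
  rewrite (starlike_quotient_dilation _ (extremal_quotient n)
             (fun z => 2 * INR n * z ^ pred n / ((1 - z ^ n) * (1 - z ^ n)))) in Hsub.
  - rewrite Erx in Hsub. cbv beta in Hsub. unfold extremal_quotient in Hsub.
    rewrite EW in Hsub.
    assert (EP : RtoC r0 * RtoC r0 ^ pred n = RtoC t).
    { rewrite <- EW, <- Cpow_S. f_equal. lia. }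
    (* The right side is z p'/p at z = r0 for p = (1 + z^n) / (1 - z^n), and [Heq] says that it
       equals [arcsinh 1]. *)
    assert (E : Carcsinh (om (RtoC x)) = RtoC (2 * INR n * t / (1 - t ^ 2))).
    { assert (Hd : (1 - t ^ 2 <> 0)%R) by nra.
      apply (f_equal (fun v => v - 1)) in Hsub.
      replace (1 + Carcsinh (om (RtoC x)) - 1) with (Carcsinh (om (RtoC x))) in Hsub by ring.
      rewrite <- Hsub. rewrite RtoC_div, !RtoC_mult, RtoC_minus, RtoC_pow by exact Hd.
      transitivity (2 * INR n * (RtoC r0 * RtoC r0 ^ pred n) / (1 - RtoC t ^ 2)).
      - field. repeat split; try assumption.
        replace (1 - RtoC t ^ 2) with ((1 - RtoC t) * (1 + RtoC t)) by ring.
        apply Cmult_neq_0; assumption.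
      - rewrite EP. reflexivity. }
    rewrite E in Hlt. simpl in Hlt.
    replace (2 * INR n * t / (1 - t * (t * 1)))%R with (arcsinh 1) in Hlt; [lra|].
    rewrite Heq. field. nra.
  - intros w. reflexivity.
  - lra.
  - exact Hz.
  - apply RtoC_neq_0. lra.
  - rewrite Erx. apply is_Cderive_extremal_quotient; assumption.
  - rewrite Erx. unfold extremal_quotient, Cdiv. rewrite EW.
    apply Cmult_neq_0; [exact Hne2|]. intros E.
    apply C1_nz. rewrite <- (Cinv_r (1 - RtoC t)) by exact Hne. rewrite E. ring.
Qed.

Theorem theorem4p3 (n : nat) (hn : (1 <= n)%nat) :
  is_class_radius (class_Srho_n n) (class_S n)
    (Rpower (arcsinh 1 / (INR n + sqrt (INR n ^ 2 + arcsinh 1 ^ 2)))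
            (1 / INR n))%R.
Proof.
  assert (Hn0 : (0 < INR n)%R) by (apply lt_0_INR; lia).
  destruct (radius_equation (INR n) (arcsinh 1) Hn0 arcsinh_1_pos) as [Ht Heq].
  set (t := (arcsinh 1 / (INR n + sqrt (INR n ^ 2 + arcsinh 1 ^ 2)))%R) in *.
  set (r0 := Rpower t (1 / INR n)).
  assert (Hr0n : (r0 ^ n = t)%R) by (apply Rpower_root_pow; [exact hn | lra]).
  assert (Hr0 : (0 < r0)%R) by apply exp_pos.
  assert (Hr01 : (r0 < 1)%R) by (apply (pow_lt_1_inv r0 n); lra).
  split; [split; [lra|]|].
  - intros g r Hg Hr. apply class_S_dilation_Srho; [exact hn | exact Hg | lra|].
    pose proof (pow_incr r r0 n ltac:(lra)) as Hp. rewrite Hr0n in Hp.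
    pose proof (pow_lt r n ltac:(lra)). pose proof arcsinh_1_pos.
    (* For r <= r0 the left side grows with r and the right side decreases, so the equality at r0
       yields the inequality. *)
    apply Rle_trans with (2 * INR n * t)%R; [apply Rmult_le_compat_l; lra|].
    rewrite Heq. apply Rmult_le_compat_l; [lra|]. nra.
  - intros r1 [Hr1 Hadm]. apply Rnot_lt_le. intros Hlt.
    apply (extremal_not_Srho n r0 r1 hn); [lra | lra | rewrite Hr0n; exact Heq|].
    apply (Hadm _ r1 (class_S_extremal n hn)). lra.
Qed.
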